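(* Let $s,t\in\mathbb Z_{\ge0}$. Then $X_{st}=X_sX_t$. In particular, if $\gcd(s,t)=1$, then $S(X_{st})=S(X_s)S(X_t)$.
   Context: $\Lambda$ is the graded ring of symmetric functions over $\mathbb Z$; $m_\lambda,h_\lambda,p_\lambda$ are the monomial, complete homogeneous and power sum symmetric functions indexed by partitions $\lambda$. For $s\in\mathbb Z_{\ge 0}$ the bilinear form $\langle\cdot,\cdot\rangle_s$ on $\mathbb C\otimes\Lambda$ is given by $\langle p_\lambda,p_\mu\rangle_s=\delta_{\lambda\mu}s^{l(\lambda)}z_\lambda$, where $l(\lambda)$ is the number of parts of $\lambda$ (with $0^0=1$) and $z_\lambda=\prod_{r\ge1}r^{m_r}m_r!$ for $\lambda=(1^{m_1}2^{m_2}\cdots)$; it restricts to a $\mathbb Z$-valued form on $\Lambda$. $X_s$ is the matrix $(\langle m_\lambda,h_\mu\rangle_s)_{\lambda,\mu}$, rows and columns indexed by partitions. It is block diagonal with one finite block for each degree $d=|\lambda|=|\mu|$, and the statement is understood degree by degree. $S(X)$ denotes the Smith normal form of an integer matrix $X$ (diagonal, nonnegative entries, each dividing the next). *)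

(* Defs.v *)
From HB Require Import structures.
From mathcomp Require Import all_boot all_order all_algebra perm.
From mathcomp Require Import boolp reals complex mpoly.

Set Implicit Arguments.
Unset Strict Implicit.
Unset Printing Implicit Defensive.

Import Order.TTheory GRing.Theory Num.Theory.
Local Open Scope ring_scope.

(* The ring of symmetric functions with coefficients in R is the graded
   inverse limit of the rings of symmetric polynomials in n variables, along
   the maps that set the last variable to 0 (Macdonald, I.2): an element is a
   compatible family of symmetric polynomials of bounded degree. *)

Section Families.
Variable R : comNzRingType.

Definition polyfam := forall n, {mpoly R[n]}.

HB.instance Definition _ := gen_eqMixin polyfam.
HB.instance Definition _ := gen_choiceMixin polyfam.

Implicit Types f g h : polyfam.

Definition fam_zero : polyfam := fun n => 0.
Definition fam_one : polyfam := fun n => 1.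
Definition fam_opp f : polyfam := fun n => - f n.
Definition fam_add f g : polyfam := fun n => f n + g n.
Definition fam_mul f g : polyfam := fun n => f n * g n.
Definition fam_scale (c : R) f : polyfam := fun n => c *: f n.

Fact fam_addA : associative fam_add.
Proof. by move=> f g h; apply: functional_extensionality_dep => n; exact: addrA. Qed.
Fact fam_addC : commutative fam_add.
Proof. by move=> f g; apply: functional_extensionality_dep => n; exact: addrC. Qed.
Fact fam_add0 : left_id fam_zero fam_add.
Proof. by move=> f; apply: functional_extensionality_dep => n; exact: add0r. Qed.
Fact fam_addN : left_inverse fam_zero fam_opp fam_add.
Proof. by move=> f; apply: functional_extensionality_dep => n; exact: addNr. Qed.

HB.instance Definition _ :=
  GRing.isZmodule.Build polyfam fam_addA fam_addC fam_add0 fam_addN.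

Fact fam_mulA : associative fam_mul.
Proof. by move=> f g h; apply: functional_extensionality_dep => n; exact: mulrA. Qed.
Fact fam_mulC : commutative fam_mul.
Proof. by move=> f g; apply: functional_extensionality_dep => n; exact: mulrC. Qed.
Fact fam_mul1 : left_id fam_one fam_mul.
Proof. by move=> f; apply: functional_extensionality_dep => n; exact: mul1r. Qed.
Fact fam_mulD : left_distributive fam_mul fam_add.
Proof. by move=> f g h; apply: functional_extensionality_dep => n; exact: mulrDl. Qed.
Fact fam_one_neq0 : fam_one != 0.
Proof.
apply/eqP => /(congr1 (fun f : polyfam => f 0%N)) /eqP.
by rewrite /fam_one oner_eq0.
Qed.

HB.instance Definition _ := GRing.Zmodule_isComNzRing.Build polyfam
  fam_mulA fam_mulC fam_mul1 fam_mulD fam_one_neq0.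

Fact fam_scaleA a b f : fam_scale a (fam_scale b f) = fam_scale (a * b) f.
Proof. by apply: functional_extensionality_dep => n; exact: scalerA. Qed.
Fact fam_scale1 : left_id 1 fam_scale.
Proof. by move=> f; apply: functional_extensionality_dep => n; exact: scale1r. Qed.
Fact fam_scaleDr : right_distributive fam_scale +%R.
Proof. by move=> a f g; apply: functional_extensionality_dep => n; exact: scalerDr. Qed.
Fact fam_scaleDl f : {morph fam_scale^~ f : a b / a + b}.
Proof. by move=> a b; apply: functional_extensionality_dep => n; exact: scalerDl. Qed.

HB.instance Definition _ := GRing.Zmodule_isLmodule.Build R polyfam
  fam_scaleA fam_scale1 fam_scaleDr fam_scaleDl.

Fact fam_scaleAl (a : R) f g : a *: (f * g) = a *: f * g.
Proof. by apply: functional_extensionality_dep => n; exact: scalerAl. Qed.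

HB.instance Definition _ := GRing.Lmodule_isLalgebra.Build R polyfam fam_scaleAl.
HB.instance Definition _ := GRing.Lalgebra_isComAlgebra.Build R polyfam.

Definition kill_last n (i : 'I_n.+1) : {mpoly R[n]} :=
  if unlift ord_max i is Some j then 'X_j else 0.

Definition restr n (p : {mpoly R[n.+1]}) : {mpoly R[n]} :=
  p \mPo [tuple kill_last i | i < n.+1].

Definition is_symfun f : Prop :=
  [/\ forall n, f n \is symmetric,
      forall n, restr (f n.+1) = f n
    & exists D, forall n, (msize (f n) <= D)%N].

Definition symfun_pred : pred polyfam := fun f => `[< is_symfun f >].

Fact symfun_subalg_closed : subalg_closed symfun_pred.
Proof.
split.
- apply/asboolP; split=> [n|n|]; [exact: rpred1|exact: rmorph1|].
  by exists 1%N => n; rewrite msize1.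
- move=> c f g /asboolP[fs fr [D fD]] /asboolP[gs gr [E gE]].
  apply/asboolP; split=> [n|n|].
  + by apply/issymP => s; rewrite raddfD /= msymZ !(issymP _ _).
  + by rewrite /restr raddfD /= [X in X + _]linearZ /= -/(restr _) fr -/(restr _) gr.
  + exists (maxn D E) => n.
    apply: leq_trans (msizeD_le _ _) _; rewrite geq_max !leq_max.
    by rewrite gE orbT (leq_trans (msizeZ_le _ _) (fD n)).
- move=> f g /asboolP[fs fr [D fD]] /asboolP[gs gr [E gE]].
  apply/asboolP; split=> [n|n|].
  + by apply/issymP => s; rewrite rmorphM /= !(issymP _ _).
  + by rewrite /restr rmorphM /= -/(restr _) fr -/(restr _) gr.
  + exists (D + E).+1 => n.
    by apply: leq_trans (msizeM_le _ _) _; rewrite ltnS leq_add.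
Qed.

HB.instance Definition _ :=
  GRing.isSubalgClosed.Build R polyfam symfun_pred symfun_subalg_closed.

Record symfun := SymFun { symfun_fam : polyfam; _ : symfun_pred symfun_fam }.

HB.instance Definition _ := [isSub for symfun_fam].
HB.instance Definition _ := [Choice of symfun by <:].
HB.instance Definition _ := [SubChoice_isSubComNzRing of symfun by <:].
HB.instance Definition _ := [SubZmodule_isSubLmodule of symfun by <:].
HB.instance Definition _ := [SubNzRing_SubLmodule_isSubLalgebra of symfun by <:].
HB.instance Definition _ := [SubLalgebra_isSubAlgebra of symfun by <:].

Definition nvars (f : symfun) n : {mpoly R[n]} := symfun_fam f n.

End Families.

Coercion nvars : symfun >-> Funclass.

Lemma symfun_predP (R : comNzRingType) (f : polyfam R) :
  reflect (is_symfun f) (symfun_pred f).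
Proof. exact: asboolP. Qed.

(* Nonzero exponents of a monomial, in the order of the variables. *)
Definition exponents n (m : 'X_{1..n}) : seq nat :=
  [seq e <- [seq m i | i <- enum 'I_n] | e != 0%N].

Section Generators.
Variable R : comNzRingType.

Definition monomial_fam (la : seq nat) : polyfam R := fun n =>
  \sum_(m : 'X_{1..n < (sumn la).+1} | perm_eq (exponents m) la) 'X_[m].

Definition complete_fam (k : nat) : polyfam R := fun n =>
  \sum_(m : 'X_{1..n < k.+1} | mdeg m == k) 'X_[m].

Definition power_fam (k : nat) : polyfam R := fun n => \sum_(i < n) 'X_i ^+ k.

Lemma kill_last_widen n (j : 'I_n) :
  kill_last R (widen_ord (leqnSn n) j) = 'X_j.
Proof.
rewrite /kill_last; case: unliftP => [k|] /(congr1 val) /=.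
  by rewrite /bump leqNgt ltn_ord add0n => jk; congr 'X_(_); apply: val_inj.
by move/eqP; rewrite ltn_eqF.
Qed.

Lemma kill_last_max n : kill_last R (@ord_max n) = 0.
Proof. by rewrite /kill_last unlift_none. Qed.

Lemma mcoeff_restr n (p : {mpoly R[n.+1]}) m :
  (restr p)@_m = p@_(mnmwiden m).
Proof.
rewrite {2}[p]mpolyE /restr comp_mpolyE !raddf_sum /=.
apply: eq_bigr => k _; rewrite !mcoeffZ; congr (_ * _).
rewrite mcoeffX big_ord_recr /= tnth_mktuple kill_last_max.
under eq_bigr => i _ do rewrite tnth_mktuple kill_last_widen.
have [k0|k_neq0] := eqVneq (k ord_max) 0%N.
  rewrite k0 expr0 mulr1.
  pose k' := [multinom k (widen_ord (leqnSn n) i) | i < n].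
  have -> : \prod_(i < n) 'X_i ^+ k (widen_ord (leqnSn n) i) = 'X_[k'] :> {mpoly R[n]}.
    by rewrite [RHS]mpolyXE_id; apply: eq_bigr => i _; rewrite mnmE.
  have -> : k = mnmwiden k'.
    apply/mnmP => i; case: (unliftP ord_max i) => [j ->|->].
      have -> : lift ord_max j = widen_ord (leqnSn n) j.
        by apply/val_inj; rewrite /= /bump leqNgt ltn_ord.
      by rewrite mnmwiden_widen mnmE.
    by rewrite mnmwiden_ordmax.
  by rewrite mcoeffX (inj_eq (@inj_mnmwiden n)).
rewrite expr0n (negPf k_neq0) mulr0 mcoeff0.
case: eqP => // kE; move: k_neq0.
by rewrite kE mnmwiden_ordmax eqxx.
Qed.

Lemma mcoeff_sum_monomials n b (P : pred 'X_{1..n}) (m : 'X_{1..n}) :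
  (\sum_(k : 'X_{1..n < b} | P k) 'X_[k] : {mpoly R[n]})@_m
  = (P m && (mdeg m < b)%N)%:R.
Proof.
rewrite raddf_sum /=; under eq_bigr => k _ do rewrite mcoeffX.
have [lt_mb|ge_mb] := boolP (mdeg m < b)%N; last first.
  rewrite andbF big1 // => k _; case: eqP => // kE.
  by move: ge_mb; rewrite -kE bmdeg.
rewrite andbT big_mkcond (bigD1 (BMultinom lt_mb)) //= eqxx big1.
  by rewrite addr0; case: (P m).
move=> k; case: (bmnm k =P m) => [kE /eqP[]|_ _]; first exact: val_inj.
by case: (P k).
Qed.

Lemma sumn_exponents n (m : 'X_{1..n}) : sumn (exponents m) = mdeg m.
Proof.
rewrite /exponents sumnE big_filter big_map mdegE big_mkcond /= big_enum /=.
by apply: eq_bigr => i _; case: eqP => // ->.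
Qed.

Lemma exponents_perm n (m : 'X_{1..n}) (s : 'S_n) :
  perm_eq (exponents [multinom m (s i) | i < n]) (exponents m).
Proof.
apply: perm_filter.
rewrite (eq_map (fun i => mnmE (fun i => m (s i)) i)) (map_comp m s).
apply/perm_map/uniq_perm; rewrite ?enum_uniq //.
  by rewrite map_inj_uniq ?enum_uniq //; exact: perm_inj.
move=> i; rewrite mem_enum; apply/mapP.
by exists (s^-1 i)%g; rewrite ?mem_enum ?permKV.
Qed.

Lemma exponents_mnmwiden n (m : 'X_{1..n}) :
  exponents (mnmwiden m) = exponents m.
Proof.
rewrite /exponents enum_ordSr map_rcons filter_rcons mnmwiden_ordmax /=.
rewrite -map_comp; congr filter; apply: eq_map => i /=.
by rewrite mnmwiden_widen.
Qed.

Lemma mdeg_mnmwiden n (m : 'X_{1..n}) : mdeg (mnmwiden m) = mdeg m.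
Proof. by rewrite -!sumn_exponents exponents_mnmwiden. Qed.

Lemma msize_sum_monomials n b (P : pred 'X_{1..n}) :
  (msize (\sum_(k : 'X_{1..n < b} | P k) 'X_[k] : {mpoly R[n]}) <= b)%N.
Proof.
rewrite msizeE; apply/bigmax_leqP_seq => m; rewrite mcoeff_msupp.
by rewrite mcoeff_sum_monomials; case: (mdeg m < b)%N => //; rewrite andbF eqxx.
Qed.

Lemma mcoeff_monomial la n m :
  (monomial_fam la n)@_m = (perm_eq (exponents m) la)%:R.
Proof.
rewrite (mcoeff_sum_monomials _ (fun m => perm_eq (exponents m) la)) ltnS.
have [/perm_sumn|//] := boolP (perm_eq _ _).
by rewrite sumn_exponents => ->; rewrite leqnn.
Qed.

Lemma mcoeff_complete k n m : (complete_fam k n)@_m = (mdeg m == k)%:R.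
Proof.
rewrite (mcoeff_sum_monomials _ (fun m => mdeg m == k)) ltnS.
by case: eqP => // ->; rewrite leqnn.
Qed.

Lemma monomial_symfun la : symfun_pred (monomial_fam la).
Proof.
apply/symfun_predP; split=> [n|n|].
- apply/issymP => s; apply/mpolyP => m.
  rewrite mcoeff_sym !mcoeff_monomial.
  by rewrite (permPl (exponents_perm m s)).
- by apply/mpolyP => m; rewrite mcoeff_restr !mcoeff_monomial exponents_mnmwiden.
- exists (sumn la).+1 => n.
  exact: (@msize_sum_monomials _ _ (fun m => perm_eq (exponents m) la)).
Qed.

Lemma complete_symfun k : symfun_pred (complete_fam k).
Proof.
apply/symfun_predP; split=> [n|n|].
- apply/issymP => s; apply/mpolyP => m.
  by rewrite mcoeff_sym !mcoeff_complete mdeg_mperm.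
- by apply/mpolyP => m; rewrite mcoeff_restr !mcoeff_complete mdeg_mnmwiden.
- exists k.+1 => n.
  exact: (@msize_sum_monomials _ _ (fun m => mdeg m == k)).
Qed.

Lemma power_symfun k : symfun_pred (power_fam k.+1).
Proof.
apply/symfun_predP; split=> [n|n|].
- apply/issymP => s; rewrite /power_fam raddf_sum /=.
  rewrite [RHS](reindex_inj (@perm_inj _ s)) /=; apply: eq_bigr => i _.
  rewrite rmorphXn /= msymX; congr ('X_[_] ^+ _); apply/mnmP => j.
  by rewrite mnmE !mnm1E -(inj_eq (@perm_inj _ s)) permKV.
- rewrite /power_fam /restr raddf_sum big_ord_recr /= rmorphXn /=.
  rewrite comp_mpolyXU -tnth_nth tnth_mktuple kill_last_max expr0n addr0.
  apply: eq_bigr => i _; rewrite rmorphXn /= comp_mpolyXU -tnth_nth.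
  by rewrite tnth_mktuple kill_last_widen.
- exists k.+2 => n; rewrite msizeE; apply/bigmax_leqP_seq => m.
  rewrite mcoeff_msupp raddf_sum /= => m_neq0 _.
  have /existsP[j] : [exists i : 'I_n, ('X_i ^+ k.+1 : {mpoly R[n]})@_m != 0].
    apply: contraNT m_neq0 => /existsPn H.
    by rewrite big1 // => i _; apply/eqP; have := H i; rewrite negbK.
  rewrite mpolyXn mcoeffX; case: (_ =P m) => [<- _|_]; last by rewrite eqxx.
  by rewrite mdegMn mdeg1 mul1n.
Qed.
End Generators.

Definition is_part (la : seq nat) := sorted geq la && (0%N \notin la).

Record intpart (d : nat) := IntPart {
  intpart_seq :> seq nat;
  _ : is_part intpart_seq && (sumn intpart_seq == d) }.

HB.instance Definition _ d := [isSub for @intpart_seq d].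
HB.instance Definition _ d := [Countable of intpart d by <:].

Lemma intpart_is_part d (la : intpart d) : is_part la.
Proof. by case: la => s /= /andP[]. Qed.

Lemma sumn_intpart d (la : intpart d) : sumn la = d.
Proof. by case: la => s /= /andP[_ /eqP]. Qed.

Lemma leq_mem_sumn (s : seq nat) i : i \in s -> (i <= sumn s)%N.
Proof.
elim: s => //= j s IHs; rewrite inE => /orP[/eqP->|/IHs]; first exact: leq_addr.
by move=> /leq_trans; apply; exact: leq_addl.
Qed.

Lemma part_size_le la : is_part la -> (size la <= sumn la)%N.
Proof.
case/andP=> _; elim: la => //= i s IHs.
by rewrite inE negb_or eq_sym -lt0n => /andP[i_gt0 /IHs]; rewrite -add1n; exact: leq_add.
Qed.

Definition intpart_bseq d (la : intpart d) : d.-bseq 'I_d.+1 :=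
  insub_bseq d (map inord la).
Definition bseq_intpart d (b : d.-bseq 'I_d.+1) : option (intpart d) :=
  insub (map val b).

Fact intpart_bseqK d : pcancel (@intpart_bseq d) (@bseq_intpart d).
Proof.
move=> la; rewrite /bseq_intpart /intpart_bseq.
have sz_la : (size (map (@inord d) la) <= d)%N.
  by rewrite size_map -{2}(sumn_intpart la) part_size_le ?intpart_is_part.
rewrite /insub_bseq insubdK //= -map_comp map_id_in ?valK // => i la_i /=.
by rewrite inordK // ltnS -(sumn_intpart la) leq_mem_sumn.
Qed.

HB.instance Definition _ d :=
  isFinite.Build (intpart d) (pcan_enumP (@intpart_bseqK d)).

Definition zpart (la : seq nat) : nat :=
  \prod_(1 <= r < (sumn la).+1) (r ^ count_mem r la * (count_mem r la)`!).

Section Bases.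
Variable R : comNzRingType.

Definition sym_complete k : symfun R := SymFun (complete_symfun R k).

(* The families x_1^0 + ... + x_n^0 are not compatible, so p_0 has no meaning;
   it does not occur in the power sums indexed by partitions. *)
Definition sym_power k : symfun R :=
  if k is k'.+1 then SymFun (power_symfun R k') else 1.

Definition sym_m la : symfun R := SymFun (monomial_symfun R la).
Definition sym_h (la : seq nat) : symfun R := \prod_(i <- la) sym_complete i.
Definition sym_p (la : seq nat) : symfun R := \prod_(i <- la) sym_power i.

End Bases.

(* The scalar extension of the ring of symmetric functions over Z to a field C
   is symfun C. The power sums indexed by partitions form a basis of it, so
   that sym_form below is determined by its values on them; the coordinates in
   this basis are introduced to prove that it exists. *)

Section Coordinates.
Variable C : numFieldType.
Implicit Types (la mu : seq nat) (f g : symfun C).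

Definition part_monom n la : 'X_{1..n} := [multinom nth 0%N la i | i < n].

Definition part_coef n la f : C := (f n)@_(part_monom n la).

Lemma part_coefP n la a f g :
  part_coef n la (a *: f + g) = a * part_coef n la f + part_coef n la g.
Proof. by rewrite /part_coef mcoeffD mcoeffZ. Qed.

Lemma symfun_prod (I : Type) (r : seq I) (F : I -> symfun C) n :
  (\prod_(i <- r) F i : symfun C) n = \prod_(i <- r) F i n.
Proof. by elim/big_rec2: _ => // i y x _ <-. Qed.

Definition place_monom n la (phi : {ffun 'I_(size la) -> 'I_n}) : 'X_{1..n} :=
  (\sum_(i < size la) U_(phi i) *+ nth 0%N la i)%MM.

Lemma sym_pE n la : is_part la ->
  sym_p C la n = \sum_(phi : {ffun 'I_(size la) -> 'I_n}) 'X_[place_monom phi].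
Proof.
move=> /andP[_ la0]; rewrite symfun_prod (big_nth 0%N) big_mkord.
transitivity (\prod_(i < size la) \sum_(j < n) ('X_j ^+ nth 0%N la i : {mpoly C[n]})).
  apply: eq_bigr => i _.
  have: nth 0%N la i != 0%N by apply: contraNneq la0 => <-; exact: mem_nth.
  by case: (nth 0%N la i).
rewrite bigA_distr_bigA /=; apply: eq_bigr => phi _.
by rewrite /place_monom -mprodXE; apply: eq_bigr => i _; rewrite mpolyXn.
Qed.

Lemma part_coef_sym_p n mu la : is_part la ->
  part_coef n mu (sym_p C la) = #|[pred phi | place_monom phi == part_monom n mu
     & phi \in {: {ffun 'I_(size la) -> 'I_n}}]|%:R.
Proof.
move=> la_part; rewrite /part_coef sym_pE // raddf_sum /=.
under eq_bigr => phi _ do rewrite mcoeffX.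
by rewrite -natr_sum -big_mkcond /= sum1_card; congr _%:R; apply: eq_card => phi; rewrite !inE andbT.
Qed.

Lemma mdeg_part_monom n mu : (size mu <= n)%N -> mdeg (part_monom n mu) = sumn mu.
Proof.
move=> le_mu; rewrite mdegE; under eq_bigr => i _ do rewrite mnmE.
rewrite sumnE (big_nth 0%N) -(big_mkord xpredT) (@big_cat_nat _ _ _ (size mu)) //=.
rewrite [X in (_ + X)%N]big1_seq ?addn0 // => i.
by rewrite mem_index_iota => /andP[_ /andP[? _]]; rewrite nth_default.
Qed.

Lemma place_monom_part n la mu (phi : {ffun 'I_(size la) -> 'I_n}) :
    is_part la -> is_part mu -> (size mu <= n)%N ->
    place_monom phi = part_monom n mu ->
  [/\ sumn la = sumn mu, (size mu <= size la)%N
    & size mu = size la -> la = mu].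
Proof.
move=> /andP[la_s la0] /andP[mu_s mu0] le_mu E.
have Ei (j : 'I_n) : nth 0%N mu j = (\sum_(i < size la | phi i == j) nth 0%N la i)%N.
  move/(congr1 (fun m : 'X_{1..n} => m j)): E; rewrite mnmE => <-.
  rewrite mnm_sumE [RHS]big_mkcond; apply: eq_bigr => i _.
  by rewrite mulmnE mnm1E; case: eqP; rewrite ?mul1n ?mul0n.
pose s := [seq val (phi i) | i <- enum 'I_(size la)].
have sz_s : size s = size la by rewrite size_map size_enum_ord.
have sub : {subset iota 0 (size mu) <= s}.
  move=> j; rewrite mem_iota add0n => /andP[_ lt_j].
  have lt_jn : (j < n)%N by exact: leq_trans lt_j le_mu.
  have: nth 0%N mu j != 0%N by apply: contraNneq mu0 => <-; exact: mem_nth.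
  rewrite -[j]/(val (Ordinal lt_jn)) Ei => sum_neq0.
  have /existsP[k /eqP kE] : [exists k, phi k == Ordinal lt_jn].
    apply: contraNT sum_neq0 => /existsPn H.
    by rewrite big1 // => k; rewrite (negPf (H k)).
  by apply/mapP; exists k; rewrite ?mem_enum ?kE.
split.
- move/(congr1 (@mdeg n)): E; rewrite mdeg_part_monom // => <-.
  rewrite /place_monom mdeg_sum sumnE (big_nth 0%N) big_mkord.
  by apply: eq_bigr => i _; rewrite mdegMn mdeg1 mul1n.
- by rewrite -(size_iota 0 (size mu)) -sz_s; apply: uniq_leq_size => //; exact: iota_uniq.
- move=> sz; have sz_le : (size s <= size (iota 0 (size mu)))%N.
    by rewrite size_iota sz_s sz.
  have [_ s_eq] := uniq_min_size (iota_uniq 0 (size mu)) sub sz_le.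
  have s_uniq := leq_size_uniq (iota_uniq 0 (size mu)) sub sz_le.
  have phi_inj : injective phi.
    have /injectiveP inj : injectiveb (fun i => val (phi i)) by [].
    by move=> i j ij; apply: inj; rewrite ij.
  have laE (i : 'I_(size la)) : nth 0%N mu (phi i) = nth 0%N la i.
    by rewrite Ei (big_pred1 i) // => j; rewrite (inj_eq phi_inj).
  apply: (sorted_eq (leT := geq)) => //.
  + by move=> ? ? ? /= h1 h2; exact: leq_trans h2 h1.
  + by move=> ? ? /= /anti_leq.
  have -> : la = map (nth 0%N mu) s.
    rewrite -map_comp -[LHS](mkseq_nth 0%N) /mkseq -val_enum_ord -map_comp.
    by apply: eq_map => i /=; rewrite laE.
  rewrite -[X in perm_eq _ X](mkseq_nth 0%N); apply: perm_map.
  by rewrite perm_sym uniq_perm ?iota_uniq.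
Qed.

Lemma place_monom_id n la : (size la <= n)%N ->
  exists phi : {ffun 'I_(size la) -> 'I_n}, place_monom phi = part_monom n la.
Proof.
move=> le_la; exists [ffun i => widen_ord le_la i]; apply/mnmP => j.
rewrite mnmE mnm_sumE.
have [lt_j|ge_j] := ltnP j (size la); last first.
  rewrite nth_default // big1 // => i _; rewrite mulmnE mnm1E ffunE.
  by case: eqP => [ij|_]; rewrite ?mul0n //; move: ge_j; rewrite -ij /= leqNgt ltn_ord.
rewrite (bigD1 (Ordinal lt_j)) //= big1 => [|i ij].
  by rewrite mulmnE mnm1E ffunE (_ : _ == j) ?mul1n ?addn0 //; apply/eqP/val_inj.
rewrite mulmnE mnm1E ffunE; case: eqP => // wE; case/eqP: ij.
by apply/val_inj; rewrite /= -wE.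
Qed.

Definition power_mx d : 'M[C]_#|{: intpart d}| :=
  \matrix_(i, j) part_coef d (enum_val j : intpart d) (sym_p C (enum_val i : intpart d)).

Lemma power_mx_neq0 d (la mu : intpart d) :
    part_coef d mu (sym_p C la) != 0 ->
  (size mu <= size la)%N /\ (size mu = size la -> la = mu).
Proof.
have [la_p mu_p] := (intpart_is_part la, intpart_is_part mu).
rewrite part_coef_sym_p // pnatr_eq0 -lt0n => /card_gt0P[phi].
rewrite !inE andbT => /eqP phiE.
have le_mu : (size mu <= d)%N by rewrite -{2}(sumn_intpart mu) part_size_le.
have [_ le_sz eq_sz] := place_monom_part la_p mu_p le_mu phiE.
by split=> // /eq_sz /val_inj.
Qed.

Lemma power_mx_diag d (la : intpart d) : part_coef d la (sym_p C la) != 0.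
Proof.
have la_p := intpart_is_part la.
have le_la : (size la <= d)%N by rewrite -{2}(sumn_intpart la) part_size_le.
have [phi phiE] := place_monom_id le_la.
rewrite part_coef_sym_p // pnatr_eq0 -lt0n; apply/card_gt0P.
by exists phi; rewrite !inE phiE eqxx.
Qed.

Lemma power_mx_unit d : power_mx d \in unitmx.
Proof.
rewrite -row_free_unit -kermx_eq0; apply/eqP/row_matrixP => k.
rewrite row0; set c := row k _.
have cP : c *m power_mx d = 0 by rewrite -row_mul mulmx_ker row0.
clearbody c.
apply/eqP/negPn/negP => /eqP c_neq0.
have [i0 ci0] : exists i, c 0 i != 0.
  apply/existsP; apply: contra_notT c_neq0 => /existsPn H.
  by apply/rowP => i; move: (H i); rewrite negbK => /eqP ->; rewrite mxE.
case: (@arg_maxnP _ i0 (fun i => c 0 i != 0)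
  (fun i => size (enum_val i : intpart d)) ci0) => j cj jmax.
have := congr1 (fun A : 'rV_ _ => A 0 j) cP; rewrite /= !mxE (bigD1 j) //= big1.
  by rewrite addr0 mxE => /eqP; rewrite mulf_eq0 (negPf cj) (negPf (power_mx_diag _)).
move=> i ij; rewrite mxE; apply/eqP; rewrite mulf_eq0; apply/norP => -[ci].
move=> /power_mx_neq0[le_ji eq_ji]; case/eqP: ij; apply: enum_val_inj.
by apply: eq_ji; apply/eqP; rewrite eqn_leq le_ji; exact: jmax.
Qed.

Definition coef_row d f : 'rV[C]_#|{: intpart d}| :=
  \row_j part_coef d (enum_val j : intpart d) f.

Definition p_coord d f : 'rV[C]_#|{: intpart d}| := coef_row d f *m invmx (power_mx d).

Lemma p_coordP d a f g : p_coord d (a *: f + g) = a *: p_coord d f + p_coord d g.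
Proof.
rewrite /p_coord scalemxAl -mulmxDl; congr (_ *m _).
by apply/rowP => j; rewrite !mxE part_coefP.
Qed.

Lemma p_coordPi d a f g i :
  p_coord d (a *: f + g) 0 i = a * p_coord d f 0 i + p_coord d g 0 i.
Proof. by rewrite p_coordP mxE [X in X + _]mxE. Qed.

Lemma p_coord_sym_p d (la : intpart d) :
  p_coord d (sym_p C la) = delta_mx 0 (enum_rank la).
Proof.
have -> : sym_p C la = sym_p C (enum_val (enum_rank la) : intpart d).
  by rewrite enum_rankK.
rewrite /p_coord.
have -> : coef_row d (sym_p C (enum_val (enum_rank la) : intpart d))
    = row (enum_rank la) (power_mx d) by apply/rowP => j; rewrite !mxE.
by rewrite -row_mul mulmxV ?power_mx_unit // row1.
Qed.

Lemma p_coord_sym_p0 d la : is_part la -> sumn la != d -> p_coord d (sym_p C la) = 0.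
Proof.
move=> la_p ne_d; rewrite /p_coord (_ : coef_row _ _ = 0) ?mul0mx //.
apply/rowP => j; rewrite !mxE; set mu : intpart d := enum_val j.
rewrite part_coef_sym_p // (_ : #|_| = 0%N) //; apply: eq_card0 => phi.
rewrite !inE andbT; apply: contraNF ne_d => /eqP phiE.
have mu_p := intpart_is_part mu.
have le_mu : (size mu <= d)%N by rewrite -{2}(sumn_intpart mu) part_size_le.
by have [-> _ _] := place_monom_part la_p mu_p le_mu phiE; rewrite sumn_intpart.
Qed.

Lemma p_coord_bounded f : exists D, forall d, (D <= d)%N -> p_coord d f = 0.
Proof.
have [_ _ [D fD]] : is_symfun (symfun_fam f) by apply/symfun_predP; case: f.
exists D => d le_D.
rewrite /p_coord (_ : coef_row _ _ = 0) ?mul0mx //; apply/rowP => j; rewrite !mxE.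
apply: memN_msupp_eq0; apply: msize_mdeg_ge.
set mu : intpart d := enum_val j.
have le_mu : (size mu <= d)%N.
  by rewrite -{2}(sumn_intpart mu) part_size_le ?intpart_is_part.
by rewrite mdeg_part_monom // sumn_intpart; exact: leq_trans (fD d) le_D.
Qed.

Definition p_bound f : nat := projT1 (cid (p_coord_bounded f)).

Definition p_pairing s d f g : C :=
  \sum_(i < #|{: intpart d}|)
    (s ^ size (enum_val i : intpart d) * zpart (enum_val i : intpart d))%:R
    * p_coord d f 0 i * p_coord d g 0 i.

Definition p_form s f g : C := \sum_(d < p_bound f) p_pairing s d f g.

Lemma p_pairingPl s d a f f' g :
  p_pairing s d (a *: f + f') g = a * p_pairing s d f g + p_pairing s d f' g.
Proof.
rewrite /p_pairing mulr_sumr -big_split; apply: eq_bigr => i _ /=.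
by rewrite p_coordPi mulrDr mulrDl [_ * (a * _)]mulrCA !mulrA.
Qed.

Lemma p_pairingPr s d a f g g' :
  p_pairing s d f (a *: g + g') = a * p_pairing s d f g + p_pairing s d f g'.
Proof.
rewrite /p_pairing mulr_sumr -big_split; apply: eq_bigr => i _ /=.
by rewrite p_coordPi mulrDr [_ * (a * _)]mulrCA.
Qed.

Lemma p_formE s f g N : (p_bound f <= N)%N ->
  p_form s f g = \sum_(d < N) p_pairing s d f g.
Proof.
move=> le_N; rewrite /p_form (big_ord_widen _ (fun d => p_pairing s d f g) le_N).
rewrite big_mkcond; apply: eq_bigr => d _; case: ltnP => // ge_d.
rewrite /p_pairing big1 // => i _; rewrite /p_bound in ge_d.
by case: cid ge_d => D /= /[apply] ->; rewrite mxE mulr0 mul0r.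
Qed.

Fact p_form_bilinear s : bilinear_for
  ( *%R : GRing.Scale.law C C) ( *%R : GRing.Scale.law C C) (p_form s).
Proof.
split=> [g a f f'|f a g g'].
  pose N := maxn (p_bound (a *: f + f')) (maxn (p_bound f) (p_bound f')).
  rewrite /= !(@p_formE _ _ _ N) ?leq_max ?leqnn ?orbT //.
  by rewrite mulr_sumr -big_split; apply: eq_bigr => d _; exact: p_pairingPl.
by rewrite /p_form /= mulr_sumr -big_split; apply: eq_bigr => d _; exact: p_pairingPr.
Qed.

HB.instance Definition _ s :=
  bilinear_isBilinear.Build C (symfun C) (symfun C) C *%R *%R
    (p_form s) (p_form_bilinear s).

Lemma p_form_sym_p s la mu : is_part la -> is_part mu ->
  p_form s (sym_p C la) (sym_p C mu)
  = (la == mu)%:R * (s%:R ^+ size la * (zpart la)%:R).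
Proof.
move=> la_p mu_p.
have la_d : is_part la && (sumn la == sumn la) by rewrite la_p eqxx.
pose la' := IntPart la_d.
rewrite (@p_formE _ _ _ (maxn (p_bound (sym_p C la)) (sumn la).+1)) ?leq_maxl //.
have lt_la : (sumn la < maxn (p_bound (sym_p C la)) (sumn la).+1)%N by rewrite leq_max leqnn orbT.
rewrite (bigD1 (Ordinal lt_la)) //= big1 ?addr0; last first.
  move=> d ne_d; rewrite /p_pairing big1 // => i _.
  by rewrite p_coord_sym_p0 ?mxE ?mulr0 ?mul0r // eq_sym.
rewrite /p_pairing (bigD1 (enum_rank la')) //= big1 ?addr0; last first.
  move=> i ne_i; rewrite -[la]/(la' : seq nat) p_coord_sym_p !mxE (negPf ne_i).
  by rewrite andbF mulr0 mul0r.
rewrite enum_rankK /= (p_coord_sym_p la') mxE !eqxx /= mulr1 natrM natrX.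
have [sum_eq|sum_neq] := eqVneq (sumn mu) (sumn la); last first.
  rewrite p_coord_sym_p0 // mxE mulr0; case: eqP => [E|]; last by rewrite mul0r.
  by move: sum_neq; rewrite E eqxx.
have mu_d : is_part mu && (sumn mu == sumn la) by rewrite mu_p sum_eq eqxx.
rewrite (p_coord_sym_p (IntPart mu_d)) mxE eqxx /= (inj_eq enum_rank_inj) mulrC.
by rewrite -val_eqE.
Qed.

End Coordinates.

Fact sym_form_exists (C : numFieldType) (s : nat) :
  exists B : {biscalar symfun C}, forall la mu : seq nat,
    is_part la -> is_part mu ->
    B (sym_p C la) (sym_p C mu)
    = (la == mu)%:R * (s%:R ^+ size la * (zpart la)%:R).
Proof. by exists (p_form s : {biscalar symfun C}); exact: p_form_sym_p. Qed.

Definition sym_form (C : numFieldType) (s : nat) : {biscalar symfun C} :=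
  projT1 (cid (sym_form_exists C s)).

Lemma sym_formE (C : numFieldType) (s : nat) la mu : is_part la -> is_part mu ->
  sym_form C s (sym_p C la) (sym_p C mu)
  = (la == mu)%:R * (s%:R ^+ size la * (zpart la)%:R).
Proof. exact: (projT2 (cid (sym_form_exists C s))). Qed.

Section SmithNormalForm.
Variable n : nat.
Implicit Types A D E L R : 'M[int]_n.

Definition is_smith_nf A D : Prop :=
  [/\ exists L R, [/\ L \in unitmx, R \in unitmx & A = L *m D *m R],
      is_diag_mx D,
      forall i, 0 <= D i i
    & forall i j : 'I_n, (i <= j)%N -> (D i i %| D j j)%Z].

Fact smith_nf_exists A : exists D, is_smith_nf A D.
Proof.
have [L Lu [R Ru [d d_sorted ->]]] := int_Smith_normal_form A.
pose sg (x : int) : int := if x < 0 then -1 else 1.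
have sgK x : sg x * sg x = 1 by rewrite /sg; case: ifP.
have sgM x : sg x * `|x| = x.
  rewrite /sg; case: ltrP => [x0|x0]; first by rewrite ltr0_norm // mulN1r opprK.
  by rewrite ger0_norm ?mul1r.
pose S : 'M[int]_n := diag_mx (\row_i sg d`_i).
exists (\matrix_(i, j) (`|d`_i| *+ (i == j))); split.
- exists (L *m S), R; split=> //.
    rewrite unitmx_mul Lu /=.
    have /mulmx1_unit[] // : S *m S = 1%:M.
    by rewrite mulmx_diag -diag_const_mx; congr diag_mx; apply/rowP => i; rewrite !mxE sgK.
  congr (_ *m _); rewrite -mulmxA; congr (_ *m _).
  apply/matrixP => i j; rewrite mul_diag_mx !mxE.
  by rewrite mulrnAr sgM.
- by apply/is_diag_mxP => i j ij; rewrite mxE -val_eqE (negPf ij).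
- by move=> i; rewrite mxE eqxx.
- move=> i j le_ij; rewrite !mxE !eqxx !mulr1n.
  rewrite -!abszE dvdzE !absz_nat -dvdzE.
  have [lt_j|ge_j] := ltnP j (size d); last by rewrite (nth_default 0 ge_j) dvdz0.
  apply: (sorted_leq_nth (@dvdz_trans) dvdzz 0 d_sorted) => //.
  exact: leq_ltn_trans le_ij lt_j.
Qed.

Definition smith_nf A : 'M[int]_n := projT1 (cid (smith_nf_exists A)).

Lemma smith_nfP A : is_smith_nf A (smith_nf A).
Proof. exact: (projT2 (cid (smith_nf_exists A))). Qed.

Lemma dvdz_smith_pfactor L R D E (p e : nat) (i : 'I_n) :
    prime p -> L \in unitmx -> E = L *m D *m R ->
    is_diag_mx D -> is_diag_mx E ->
    (forall i j : 'I_n, (i <= j)%N -> (D i i %| D j j)%Z) ->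
    (forall i j : 'I_n, (i <= j)%N -> (E i i %| E j j)%Z) ->
  ((p ^ e)%N %| D i i)%Z -> ((p ^ e)%N %| E i i)%Z.
Proof.
move=> p_pr Lu EE /is_diag_mxP Dd /is_diag_mxP Ed Ddvd Edvd pD.
apply/negPn/negP => pE.
have p_gt0 := prime_gt0 p_pr.
have e_gt0 : (0 < e)%N by case: e pE {pD} => //; rewrite dvdzE expn0 dvd1n.
have uE (j : 'I_n) : exists wu : int * int, (j <= i)%N ->
    E j j * wu.1 = (p ^ e.-1)%N%:Z * wu.2 /\ ~~ (p%:Z %| wu.2)%Z.
  have [le_ji|] := boolP (j <= i)%N; last by exists (0, 0).
  have pEj : ~~ ((p ^ e)%N%:Z %| E j j)%Z.
    by apply: contra pE => /dvdz_trans; apply; exact: Edvd.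
  have Ej0 : (0 < `|E j j|)%N.
    by rewrite absz_gt0; apply: contraNneq pEj => ->; exact: dvdz0.
  have lt_e : (logn p `|E j j| < e)%N.
    by rewrite ltnNge -pfactor_dvdn //; move: pEj; rewrite dvdzE absz_nat.
  have [u up uEj] := pfactor_coprime p_pr Ej0.
  exists ((p ^ (e.-1 - logn p `|E j j|))%N%:Z, (-1) ^+ (E j j < 0)%R * u%:Z) => _ /=.
  split; last by rewrite dvdzE abszMsign absz_nat -prime_coprime.
  have pe : (p ^ e.-1 = p ^ logn p `|E j j| * p ^ (e.-1 - logn p `|E j j|))%N.
    by rewrite -expnD subnKC // -ltnS prednK.
  have EjE : E j j = (-1) ^+ (E j j < 0)%R * (u * p ^ logn p `|E j j|)%N%:Z.
    by rewrite -uEj -intEsign.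
  by rewrite {1}EjE pe !PoszM [RHS]mulrC -!mulrA.
pose wu j := projT1 (cid (uE j)).
have wuP (j : 'I_n) : (j <= i)%N ->
    E j j * (wu j).1 = (p ^ e.-1)%N%:Z * (wu j).2 /\ ~~ (p%:Z %| (wu j).2)%Z.
  exact: projT2 (cid (uE j)).
pose W : 'M[int]_n := diag_mx (\row_j ((wu j).1 *+ (j <= i)%N)).
pose C : 'M[int]_n := diag_mx (\row_j ((wu j).2 *+ (j <= i)%N)).
have EWC : E *m W = (p ^ e.-1)%N%:Z *: C.
  apply/matrixP => k j; rewrite mul_mx_diag !mxE.
  have [<-|kj] := eqVneq k j; last by rewrite Ed ?mul0r ?mulr0n ?mulr0.
  have [le_ki|_] := boolP (k <= i)%N; last by rewrite !mulr0n mulr0 mul0rn mulr0.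
  by rewrite !mulr1n; have [] := wuP k le_ki.
have key (k j : 'I_n) : (i <= k)%N -> (p%:Z %| (invmx L *m C) k j)%Z.
  move=> le_ik.
  have p_neq0 : (p ^ e.-1)%N%:Z != 0 by rewrite eqz_nat -lt0n expn_gt0 p_gt0.
  rewrite -(dvdz_mul2l p_neq0) -PoszM -expnSr prednK //.
  have -> : (p ^ e.-1)%N%:Z * (invmx L *m C) k j = (D *m (R *m W)) k j.
    have <- : (p ^ e.-1)%N%:Z *: (invmx L *m C) = D *m (R *m W).
      by rewrite scalemxAr -EWC EE -!mulmxA mulKmx.
    by rewrite [RHS]mxE.
  rewrite mxE (bigD1 k) //= big1 ?addr0.
    exact: dvdz_mulr (dvdz_trans pD (Ddvd _ _ le_ik)).
  by move=> l lk; rewrite Dd ?mul0r // eq_sym.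
pose phi := map_mx (intr : int -> 'F_p) : 'M_n -> 'M_n.
have phi0 (x : int) : (p%:Z %| x)%Z = (x%:~R == 0 :> 'F_p).
  exact: dvdz_pcharf (pchar_Fp p_pr) x.
have phiLu : phi (invmx L) \in unitmx.
  by rewrite unitmxE det_map_mx rmorph_unit // -unitmxE unitmx_inv.
have rkC : (\rank (phi C) <= i)%N.
  rewrite -(mulKmx phiLu (phi C)) -map_mxM -/phi.
  have -> : phi (invmx L *m C) = pid_mx i *m phi (invmx L *m C).
    apply/matrixP => k j; rewrite [RHS]mxE (bigD1 k) //= big1 ?addr0.
      rewrite [pid_mx _ _ _]mxE eqxx /=; case: ltnP => [_|le_ik]; first by rewrite mul1r.
      by rewrite mul0r [LHS]mxE; apply/eqP; rewrite -phi0 key.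
    by move=> l; rewrite -val_eqE eq_sym /= => /negPf lk; rewrite mxE lk mul0r.
  rewrite (leq_trans (mxrankM_maxr _ _)) // (leq_trans (mxrankM_maxl _ _)) //.
  by rewrite rank_pid_mx // ltnW.
have : (\rank (pid_mx i.+1 : 'M['F_p]_n) <= i)%N.
  apply: leq_trans rkC.
  pose V : 'M['F_p]_n := diag_mx (\row_j ((wu j).2%:~R)^-1).
  have -> : pid_mx i.+1 = phi C *m V.
    apply/matrixP => k j; rewrite mul_mx_diag !mxE -val_eqE.
    have [/val_inj <-|kj] := eqVneq (val k) (val j); last by rewrite mulr0n mul0r.
    rewrite andTb ltnS mulr1n; have [le_ki|_] := boolP (k <= i)%N; last by rewrite mul0r.
    by rewrite mulr1n divff // -phi0; have [] := wuP k le_ki.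
  exact: mxrankM_maxl.
by rewrite rank_pid_mx // ltnn.
Qed.

Lemma dvdz_smith L R D E (i : 'I_n) :
    L \in unitmx -> E = L *m D *m R ->
    is_diag_mx D -> is_diag_mx E ->
    (forall i j : 'I_n, (i <= j)%N -> (D i i %| D j j)%Z) ->
    (forall i j : 'I_n, (i <= j)%N -> (E i i %| E j j)%Z) ->
  (D i i %| E i i)%Z.
Proof.
move=> Lu EE Dd Ed Ddvd Edvd.
have pf p e p_pr := @dvdz_smith_pfactor L R D E p e i p_pr Lu EE Dd Ed Ddvd Edvd.
have [->|Ei0] := eqVneq (E i i) 0; first exact: dvdz0.
have Ei_gt0 : (0 < `|E i i|)%N by rewrite absz_gt0.
have [Di0|Di0] := eqVneq (D i i) 0.
  have := pf 2%N `|E i i|%N isT; rewrite Di0 dvdz0 => /(_ isT).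
  by rewrite dvdzE absz_nat => /(dvdn_leq Ei_gt0); rewrite leqNgt ltn_expl.
have Di_gt0 : (0 < `|D i i|)%N by rewrite absz_gt0.
rewrite dvdzE; apply/dvdn_partP => // p /[!mem_primes] /and3P[p_pr _ _].
have := pf p (logn p `|D i i|) p_pr; rewrite !dvdzE !absz_nat p_part.
by apply; exact: pfactor_dvdnn.
Qed.

Lemma smith_nf_unique A D : is_smith_nf A D -> smith_nf A = D.
Proof.
have [[L [R [Lu Ru AE]]] Sd S0 Sdvd] := smith_nfP A.
move=> [[L' [R' [Lu' Ru' AE']]] Dd D0 Ddvd].
apply/matrixP => i j; have [<-|ij] := eqVneq i j; last first.
  by rewrite (is_diag_mxP Sd) // (is_diag_mxP Dd).
have inv (P Q X Y : 'M[int]_n) : P \in unitmx -> Q \in unitmx ->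
    Y = P *m X *m Q -> X = invmx P *m Y *m invmx Q.
  by move=> Pu Qu ->; rewrite -!mulmxA mulKmx // mulmxV // mulmx1.
have SE : smith_nf A = (invmx L *m L') *m D *m (R' *m invmx R).
  by rewrite [LHS](inv _ _ _ _ Lu Ru AE) {1}AE' !mulmxA.
have DE : D = (invmx L' *m L) *m smith_nf A *m (R *m invmx R').
  by rewrite [LHS](inv _ _ _ _ Lu' Ru' AE') {1}AE !mulmxA.
have u1 : invmx L *m L' \in unitmx by rewrite unitmx_mul unitmx_inv Lu.
have u2 : invmx L' *m L \in unitmx by rewrite unitmx_mul unitmx_inv Lu'.
have := dvdz_smith i u1 SE Dd Sd Ddvd Sdvd.
have := dvdz_smith i u2 DE Sd Dd Sdvd Ddvd.
rewrite !dvdzE => SD DS; rewrite -(gez0_abs (S0 i)) -(gez0_abs (D0 i)).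
by congr Posz; apply/eqP; rewrite eqn_dvd SD.
Qed.

End SmithNormalForm.

Section FormMatrix.
Variable R : realType.

(* Degree d block of X_s, rows and columns listed in the enumeration order
   of the partitions of d. *)
Definition X_mx (s d : nat) : 'M[R[i]]_#|{: intpart d}| :=
  \matrix_(i, j) sym_form R[i] s (sym_m R[i] (enum_val i : intpart d))
                                 (sym_h R[i] (enum_val j : intpart d)).

(* The form is integer-valued on symmetric functions with integer
   coefficients, so this only changes the type of the entries of X_mx. *)
Definition X_int (s d : nat) : 'M[int]_#|{: intpart d}| :=
  map_mx (fun z : R[i] => Num.floor (complex.Re z)) (X_mx s d).

End FormMatrix.

(* Main.v *)
Require Import Defs.
From mathcomp Require Import all_boot all_order all_algebra perm.
From mathcomp Require Import boolp reals complex mpoly ring.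

(** The power sums diagonalize the whole family of forms at once. Let [L] be
    the transition matrix [p_la = \sum_mu L la mu m_mu] in degree [d]. If

      (1)  <p_la, h_mu>_s = s ^ l(la) * L la mu,

    then expanding [m] in the power sums gives

      (2)  X_s = L^-1 *m diag (s ^ l(la)) *m L        (lemma [X_mx_factor]),

    so that [X_(st) = X_s X_t] is the identity [(st)^l = s^l t^l].

    For (1), [L la mu] is the coefficient of [x^mu] in [p_la], and both sides
    satisfy the same recurrence, which removes one part [r] of [la] and lowers
    one exponent of [mu] by [r]. On the left, write Newton's identity
    [k h_k = \sum_r p_r h_(k-r)] for one factor of [h_mu]
    ([newton_complete]) and move [p_r] across the form, where it acts on
    [p_la] as [s r d/dp_r] ([adjoint_power]). On the right, apply the Euler
    operator [x_i d/dx_i] to the product [p_la]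
    ([mcoeff_sym_p_recurrence]). The two meet in [sym_form_p_h].

    The second claim is about integer matrices. By (2), [m_la] evaluated on
    the alphabet in which each variable is repeated [s] times is
    [\sum_mu X_s la mu m_mu], because this substitution multiplies [p_r] by
    [s]; it also maps monomials to monomials, so the entries of [X_s] are
    natural numbers ([X_mx_nat]) and rounding them loses nothing. Moreover (2)
    gives [det X_s = s ^ k] for some [k] ([det_X_int]), so that the
    determinants of [X_s] and [X_t] are coprime when [s] and [t] are.

    It remains that [S(AB) = S(A) S(B)] when [det A] and [det B] are coprime
    ([smith_nf_mul_coprime]). The [i]-th invariant factors of [A] and of [B]
    both divide that of [AB]; being coprime, so does their product; and the
    products over all [i] agree, both being [|det A det B|], which forces
    equality for each [i] unless a determinant vanishes, in which case the
    other matrix is invertible. *)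

Set Implicit Arguments.
Unset Strict Implicit.
Unset Printing Implicit Defensive.

Import Order.TTheory GRing.Theory Num.Theory.
Local Open Scope ring_scope.

(** * Smith normal forms of products *)

Lemma eq_dvdn_prod (I : finType) (x y : I -> nat) :
    (forall i, x i %| y i)%N -> (0 < \prod_i y i)%N ->
    (\prod_i x i = \prod_i y i)%N -> x =1 y.
Proof.
move=> xy y_gt0 prod_eq i.
have y0 j : (0 < y j)%N by move: y_gt0; rewrite (bigD1 j) //= muln_gt0 => /andP[].
have le_xy j : (x j <= y j)%N by rewrite dvdn_leq.
apply/eqP; rewrite eqn_leq le_xy leqNgt; apply/negP => lt_i.
have : (\prod_i x i < \prod_i y i)%N.
  rewrite (bigD1 i) //= [ltnRHS](bigD1 i) //=.
  have z0 : (0 < \prod_(j | j != i) y j)%N by rewrite prodn_gt0.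
  apply: leq_ltn_trans (_ : (x i * \prod_(j | j != i) y j < _)%N).
    by rewrite leq_mul2l leq_prod ?orbT.
  by rewrite ltn_pmul2r.
by rewrite prod_eq ltnn.
Qed.

Section SmithProduct.
Variable n : nat.
Implicit Types A B D E : 'M[int]_n.

Lemma unitmx_absz_det A : (A \in unitmx) = (`|\det A| == 1)%N.
Proof. by rewrite unitmxE; case: (\det A) => [[|[|k]]|[|k]]. Qed.

Lemma absz_det_unitmx A : A \in unitmx -> `|\det A|%N = 1%N.
Proof. by rewrite unitmx_absz_det => /eqP. Qed.

Lemma absz_det_smith_nf A D : is_smith_nf A D ->
  `|\det A|%N = (\prod_i `|D i i|)%N.
Proof.
move=> [[L [R [Lu Ru ->]]] Dd _ _].
rewrite !det_mulmx !abszM (absz_det_unitmx Lu) (absz_det_unitmx Ru) mul1n muln1.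
have -> : D = diag_mx (\row_i D i i).
  apply/matrixP => i j; rewrite !mxE.
  by have [->|ij] := eqVneq i j; rewrite ?mulr1n // (is_diag_mxP Dd) // mulr0n.
rewrite det_diag; elim/big_rec2: _ => // i k z _ <-.
by rewrite abszM !mxE eqxx mulr1n.
Qed.

Lemma is_smith_nfMr A B D : B \in unitmx -> is_smith_nf A D -> is_smith_nf (A *m B) D.
Proof.
move=> Bu [[L [R [Lu Ru ->]]] Dd D0 Ddvd]; split=> //.
by exists L, (R *m B); rewrite unitmx_mul Lu Ru Bu !mulmxA.
Qed.

Lemma is_smith_nfMl A B D : A \in unitmx -> is_smith_nf B D -> is_smith_nf (A *m B) D.
Proof.
move=> Au [[L [R [Lu Ru ->]]] Dd D0 Ddvd]; split=> //.
by exists (A *m L), R; rewrite unitmx_mul Lu Ru Au !mulmxA.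
Qed.

Lemma smith_nf_unit A : A \in unitmx -> smith_nf A = 1%:M.
Proof.
move=> Au; apply: smith_nf_unique; split.
- by exists A, 1%:M; rewrite unitmx1 Au !mulmx1.
- exact: scalar_mx_is_diag.
- by move=> i; rewrite mxE eqxx.
- by move=> i j _; rewrite !mxE !eqxx.
Qed.

Lemma diag_mx_tr D : is_diag_mx D -> D^T = D.
Proof.
move=> /is_diag_mxP Dd; apply/matrixP => i j; rewrite mxE.
by have [->//|ij] := eqVneq i j; rewrite !Dd // eq_sym.
Qed.

(** [smith_nf (A *m B)] is [smith_nf A] multiplied on the left by a unit and on
    the right by some integer matrix, which is enough for [dvdz_smith]. *)
Lemma smith_nf_dvdMr A B i : (smith_nf A i i %| smith_nf (A *m B) i i)%Z.
Proof.
have [[L [R [Lu Ru AE]]] Dd _ Ddvd] := smith_nfP A.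
have [[L' [R' [Lu' Ru' BE]]] Ed _ Edvd] := smith_nfP (A *m B).
apply: (dvdz_smith (L := invmx L' *m L) (R := R *m B *m invmx R')) => //.
  by rewrite unitmx_mul unitmx_inv Lu'.
have -> : smith_nf (A *m B) = invmx L' *m (A *m B) *m invmx R'.
  by rewrite [in RHS]BE !mulmxA mulVmx // mul1mx mulmxK.
by rewrite {1}AE !mulmxA.
Qed.

Lemma smith_nf_tr A : smith_nf A^T = smith_nf A.
Proof.
have [[L [R [Lu Ru AE]]] Dd D0 Ddvd] := smith_nfP A.
apply: smith_nf_unique; split=> //.
exists R^T, L^T; rewrite !unitmx_tr; split=> //.
by rewrite {1}AE !trmx_mul (diag_mx_tr Dd) mulmxA.
Qed.

Lemma smith_nf_dvdMl A B i : (smith_nf B i i %| smith_nf (A *m B) i i)%Z.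
Proof. by rewrite -(smith_nf_tr B) -(smith_nf_tr (A *m B)) trmx_mul smith_nf_dvdMr. Qed.

(** Divisibility of invariant factors holds one index at a time; the
    determinant then closes the gap at all indices simultaneously. When a
    determinant is [0], coprimality makes the other matrix unimodular and that
    argument is replaced by invariance under equivalence. *)
Lemma smith_nf_mul_coprime A B : coprimez (\det A) (\det B) ->
  smith_nf (A *m B) = smith_nf A *m smith_nf B.
Proof.
move=> co_AB.
have [detA0|detA_neq0] := eqVneq (\det A) 0.
  have Bu : B \in unitmx.
    by move: co_AB; rewrite detA0 unitmx_absz_det /coprimez gcd0z.
  rewrite (smith_nf_unit Bu) mulmx1.
  exact/smith_nf_unique/is_smith_nfMr/smith_nfP.
have [detB0|detB_neq0] := eqVneq (\det B) 0.
  have Au : A \in unitmx.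
    by move: co_AB; rewrite detB0 unitmx_absz_det /coprimez gcdz0.
  rewrite (smith_nf_unit Au) mul1mx.
  exact/smith_nf_unique/is_smith_nfMl/smith_nfP.
set D := smith_nf A; set D' := smith_nf B; set E := smith_nf (A *m B).
have [_ Dd D0 Ddvd] := smith_nfP A; rewrite -/D in Dd D0 Ddvd.
have [_ Dd' D0' Ddvd'] := smith_nfP B; rewrite -/D' in Dd' D0' Ddvd'.
have [_ Ed E0 Edvd] := smith_nfP (A *m B); rewrite -/E in Ed E0 Edvd.
have detA := absz_det_smith_nf (smith_nfP A); rewrite -/D in detA.
have detB := absz_det_smith_nf (smith_nfP B); rewrite -/D' in detB.
have detE := absz_det_smith_nf (smith_nfP (A *m B)); rewrite -/E in detE.
have key : (fun i => `|D i i| * `|D' i i|)%N =1 (fun i => `|E i i|%N).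
  apply: eq_dvdn_prod => [i||].
  - rewrite Gauss_dvd; last first.
      apply: (@coprime_dvdl _ `|\det A|%N).
        by rewrite detA (bigD1 i) //= dvdn_mulr.
      apply: (@coprime_dvdr _ `|\det B|%N).
        by rewrite detB (bigD1 i) //= dvdn_mulr.
      by move: co_AB; rewrite coprimezE.
    have := smith_nf_dvdMr A B i; have := smith_nf_dvdMl A B i.
    by rewrite !dvdzE => -> ->.
  - by rewrite -detE det_mulmx absz_gt0 mulf_neq0.
  - by rewrite big_split /= -detA -detB -detE det_mulmx abszM.
apply/matrixP => i j; rewrite mxE (bigD1 i) //= big1 ?addr0 => [|k ki]; last first.
  by rewrite (is_diag_mxP Dd) ?mul0r // eq_sym.
have [<-|ij] := eqVneq i j; last by rewrite (is_diag_mxP Ed) // (is_diag_mxP Dd') ?mulr0.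
by rewrite -[LHS]gez0_abs // -key PoszM !gez0_abs.
Qed.

End SmithProduct.

(** * Homogeneous symmetric functions and the monomial and power sum bases *)

Section Expansion.
Variable C : numFieldType.
Implicit Types (f g : symfun C) (la mu nu : seq nat).

Lemma symfunP f g : (forall n m, (f n)@_m = (g n)@_m) -> f = g.
Proof.
move=> fg; apply: val_inj; apply: functional_extensionality_dep => n.
exact/mpolyP.
Qed.

Lemma symfun_lin_comb (I : Type) (r : seq I) (P : pred I)
    (c : I -> C) (F : I -> symfun C) n :
  (\sum_(i <- r | P i) c i *: F i : symfun C) n = \sum_(i <- r | P i) c i *: F i n.
Proof. by elim/big_rec2: _ => // i y x _ <-. Qed.

Lemma mcoeff_symfun_widen f n N (m : 'X_{1..n}) : (n <= N)%N ->
  exists m' : 'X_{1..N}, exponents m' = exponents m /\ (f N)@_m' = (f n)@_m.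
Proof.
move=> /subnK <-; elim: (N - n)%N => [|k [m' [em' fm']]]; first by exists m.
exists (mnmwiden m'); rewrite exponents_mnmwiden em'; split=> //.
have [_ fr _] : is_symfun (symfun_fam f) by apply/symfun_predP; case: (f).
by rewrite -fm' -mcoeff_restr [restr _]fr.
Qed.

(** Monomials in the same number of variables with the same nonzero exponents
    also have the same number of zero exponents. *)
Lemma perm_eq_exponents n (m m' : 'X_{1..n}) : perm_eq (exponents m) (exponents m') ->
  exists s : 'S_n, m = [multinom m' (s i) | i < n].
Proof.
pose v (m : 'X_{1..n}) := [seq m i | i <- enum 'I_n].
move=> e_mm'.
have v_filter0 (k : 'X_{1..n}) :
    filter (predC (fun e => e != 0%N)) (v k) = nseq (n - size (exponents k)) 0%N.
  have -> : (n - size (exponents k))%N = size (filter (predC (fun e => e != 0%N)) (v k)).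
    have := count_predC (fun e => e != 0%N) (v k).
    rewrite size_map size_enum_ord !size_filter => cE.
    exact: (canLR (addKn _) (esym cE)).
  apply/all_pred1P/allP => x; rewrite mem_filter /= negbK => /andP[/eqP -> _].
  by rewrite /= eqxx.
have v_perm : perm_eq (v m) (v m').
  rewrite -(perm_filterC (fun e => e != 0%N)) perm_sym.
  rewrite -(perm_filterC (fun e => e != 0%N)) perm_sym.
  by rewrite !v_filter0 (perm_size e_mm') perm_cat2r.
have /tuple_permP[s sE] : perm_eq (v m) [tuple m' i | i < n] by [].
exists s; apply/mnmP => i; rewrite mnmE.
have := congr1 (fun t => nth 0%N t i) sE.
rewrite (nth_map i) ?size_enum_ord // nth_ord_enum => ->.
by rewrite -tnth_nth !tnth_mktuple.
Qed.

(** Setting the last variable to [0] and permuting the variables both fix a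
    symmetric function, so its coefficients depend only on the multiset of
    nonzero exponents, even across different numbers of variables. *)
Lemma mcoeff_symfun_perm f n n' (m : 'X_{1..n}) (m' : 'X_{1..n'}) :
  perm_eq (exponents m) (exponents m') -> (f n)@_m = (f n')@_m'.
Proof.
have [M [eM fM]] := mcoeff_symfun_widen f m (leq_maxl n n').
have [M' [eM' fM']] := mcoeff_symfun_widen f m' (leq_maxr n n').
rewrite -fM -fM' -eM -eM' => /perm_eq_exponents[s ->].
have [fs _ _] : is_symfun (symfun_fam f) by apply/symfun_predP; case: (f).
rewrite -mcoeff_sym; congr (mcoeff _ _); exact: (issymP _ (fs _) s).
Qed.

Lemma exponents_part_monom n la : is_part la -> (size la <= n)%N ->
  exponents (part_monom n la) = la.
Proof.
move=> /andP[_ la0] le_n; rewrite /exponents.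
have -> : [seq part_monom n la i | i <- enum 'I_n] = mkseq (nth 0%N la) n.
  by rewrite /mkseq -val_enum_ord -map_comp; apply: eq_map => i; rewrite /= mnmE.
rewrite /mkseq -(subnKC le_n) iotaD map_cat filter_cat -/(mkseq _ _) mkseq_nth.
rewrite (all_filterP _); last by apply/allP => x xla /=; apply: contraNneq la0 => x0; rewrite -x0.
rewrite [X in _ ++ X](_ : _ = [::]) ?cats0 //.
apply/eqP; rewrite -[_ == _]negbK -has_filter; apply/hasPn => x /mapP[k].
by rewrite mem_iota negbK => /andP[? _] ->; rewrite nth_default.
Qed.

Lemma size_intpart d (la : intpart d) : (size la <= d)%N.
Proof. by rewrite -{2}(sumn_intpart la) part_size_le ?intpart_is_part. Qed.

Lemma is_part_sort la : 0%N \notin la -> is_part (sort geq la).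
Proof.
move=> la0; rewrite /is_part mem_sort la0 andbT; apply: sort_sorted.
by move=> x y; exact: leq_total.
Qed.

Lemma intpart_perm d (la mu : intpart d) : perm_eq la mu = (la == mu).
Proof.
apply/idP/eqP => [lamu|->//]; apply: val_inj; apply: (sorted_eq (leT := geq)) => //.
- by move=> ? ? ? /= h1 h2; exact: leq_trans h2 h1.
- by move=> ? ? /= /anti_leq.
- by case/andP: (intpart_is_part la).
- by case/andP: (intpart_is_part mu).
Qed.

Lemma exponents_neq0 n (m : 'X_{1..n}) : 0%N \notin exponents m.
Proof. by rewrite mem_filter eqxx. Qed.

Lemma intpart_of_exponents n d (m : 'X_{1..n}) : mdeg m = d ->
  exists la : intpart d, perm_eq (exponents m) la.
Proof.
move=> dm; have p : is_part (sort geq (exponents m)) && (sumn (sort geq (exponents m)) == d).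
  rewrite is_part_sort ?exponents_neq0 //= -dm -sumn_exponents.
  by apply/eqP/perm_sumn; rewrite perm_sort.
by exists (IntPart p); rewrite /= perm_sym perm_sort.
Qed.

Definition sym_homog d f : Prop := forall n, f n \is d.-homog.

Lemma sym_homog_mcoeff0 d f n (m : 'X_{1..n}) :
  sym_homog d f -> mdeg m != d -> (f n)@_m = 0.
Proof. by move=> /(_ n); exact: dhomog_nemf_coeff. Qed.

Lemma sym_homogP d f :
  (forall n (m : 'X_{1..n}), mdeg m != d -> (f n)@_m = 0) -> sym_homog d f.
Proof.
move=> f0 n; apply/dhomogP => m; rewrite mcoeff_msupp.
by apply: contraNeq => /f0 ->.
Qed.

(** Every monomial of degree [d] has the exponents of exactly one partition of
    [d], and [part_coef] reads the coefficient of a representative. *)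
Lemma sym_homog_expand_m d f : sym_homog d f ->
  f = \sum_(la : intpart d) part_coef d la f *: sym_m C la.
Proof.
move=> fd; apply: symfunP => n m; rewrite symfun_lin_comb raddf_sum /=.
under eq_bigr => la _ do rewrite mcoeffZ mcoeff_monomial.
have [dm|dm] := eqVneq (mdeg m) d.
  have [la ela] := intpart_of_exponents dm.
  rewrite (bigD1 la) //= ela mulr1 big1 ?addr0 => [|mu ne_mu].
    apply: mcoeff_symfun_perm.
    by rewrite exponents_part_monom ?intpart_is_part ?size_intpart.
  by rewrite (permPl ela) intpart_perm eq_sym (negPf ne_mu) mulr0.
rewrite (sym_homog_mcoeff0 fd dm) big1 // => la _.
case: (boolP (perm_eq _ _)) => [/perm_sumn|]; last by rewrite mulr0.
by rewrite sumn_exponents sumn_intpart => E; rewrite E eqxx in dm.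
Qed.

Lemma sym_homogM d e f g : sym_homog d f -> sym_homog e g -> sym_homog (d + e) (f * g).
Proof. by move=> fd ge n; apply: dhomogM. Qed.

Lemma sym_homog1 : sym_homog 0 1.
Proof. by move=> n; exact: dhomog1. Qed.

Lemma sym_homog_prod (I : Type) (r : seq I) (F : I -> symfun C) (e : I -> nat) :
  (forall i, sym_homog (e i) (F i)) ->
  sym_homog (\sum_(i <- r) e i) (\prod_(i <- r) F i).
Proof.
move=> Fe; elim/big_rec2: _ => [|i x d _ IH]; first exact: sym_homog1.
exact: sym_homogM.
Qed.

Lemma sym_homog_complete k : sym_homog k (sym_complete C k).
Proof. by apply: sym_homogP => n m ne; rewrite mcoeff_complete (negPf ne). Qed.

Lemma sym_homog_power k : sym_homog k (sym_power C k).
Proof.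
case: k => [|k]; first exact: sym_homog1.
move=> n; apply: rpred_sum => i _; rewrite mpolyXn dhomogX.
by rewrite /= mdegMn mdeg1 mul1n.
Qed.

Lemma sym_homog_p la : sym_homog (sumn la) (sym_p C la).
Proof. by rewrite sumnE; apply: sym_homog_prod; exact: sym_homog_power. Qed.

Lemma sym_p_expand d (i : 'I_#|{: intpart d}|) :
  sym_p C (enum_val i : intpart d)
  = \sum_j power_mx C d i j *: sym_m C (enum_val j : intpart d).
Proof.
have pd : sym_homog d (sym_p C (enum_val i : intpart d)).
  by rewrite -{1}(sumn_intpart (enum_val i)); exact: sym_homog_p.
rewrite [LHS](sym_homog_expand_m pd) (reindex_onto (enum_val (A := {: intpart d})) enum_rank) /=.
  apply: eq_big => [j|j _]; first by rewrite enum_valK eqxx.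
  by rewrite mxE.
by move=> la _; rewrite enum_rankK.
Qed.

Lemma sym_m_expand d (i : 'I_#|{: intpart d}|) :
  sym_m C (enum_val i : intpart d)
  = \sum_j invmx (power_mx C d) i j *: sym_p C (enum_val j : intpart d).
Proof.
under eq_bigr => j _ do rewrite sym_p_expand scaler_sumr.
rewrite exchange_big /=; under eq_bigr => k _.
  under eq_bigr => j _ do rewrite scalerA.
  rewrite -scaler_suml.
  have -> : \sum_j invmx (power_mx C d) i j * power_mx C d j k = (i == k)%:R.
    by move: (mulVmx (power_mx_unit C d)) => /matrixP/(_ i k); rewrite !mxE.
  over.
rewrite (bigD1 i) //= eqxx scale1r big1 ?addr0 // => k ki.
by rewrite eq_sym (negPf ki) scale0r.
Qed.

(** Reduces identities linear in a homogeneous symmetric function to power sums,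
    where the values of the form are prescribed. *)
Lemma sym_homog_expand_p d f : sym_homog d f ->
  exists c : intpart d -> C, f = \sum_(la : intpart d) c la *: sym_p C la.
Proof.
move=> fd.
exists (fun a : intpart d => \sum_(mu : intpart d) part_coef d mu f
   * invmx (power_mx C d) (enum_rank mu) (enum_rank a)).
rewrite {1}(sym_homog_expand_m fd).
under [RHS]eq_bigr => a _ do rewrite scaler_suml.
rewrite [RHS]exchange_big /=; apply: eq_bigr => mu _.
rewrite -[in sym_m _ _](enum_rankK mu) sym_m_expand scaler_sumr.
rewrite (reindex_onto (enum_rank (T := intpart d)) enum_val) /=; last by move=> j _; rewrite enum_valK.
apply: eq_big => [a|a _]; first by rewrite enum_rankK eqxx.
by rewrite scalerA enum_rankK.
Qed.

End Expansion.

(** * The form and multiplication by a power sum *)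

Lemma zpart_widen N la : (sumn la < N)%N ->
  zpart la = (\prod_(1 <= r < N) (r ^ count_mem r la * (count_mem r la)`!))%N.
Proof.
move=> lt_N; rewrite [RHS](@big_cat_nat _ _ _ (sumn la).+1) //=.
rewrite [X in (_ * X)%N]big1_seq ?muln1 // => r; rewrite mem_index_iota => /andP[_ /andP[lt_r _]].
rewrite (count_memPn _) ?fact0 //; apply/negP => /leq_mem_sumn.
by rewrite leqNgt lt_r.
Qed.

Lemma zpart_cons r la : (0 < r)%N -> zpart (r :: la) = (r * (count_mem r la).+1 * zpart la)%N.
Proof.
move=> r_gt0; rewrite [in RHS](@zpart_widen (sumn (r :: la)).+1) ?ltnS ?leq_addl //.
rewrite /zpart.
have r_in : r \in index_iota 1 (sumn (r :: la)).+1.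
  by rewrite mem_index_iota r_gt0 ltnS leq_addr.
rewrite !(bigD1_seq r r_in) ?iota_uniq //= eqxx add1n.
rewrite [in LHS](eq_bigr (fun x => (x ^ count_mem x la * (count_mem x la)`!)%N)).
  by rewrite expnS factS !mulnA; congr (_ * _ * _)%N; rewrite -!mulnA; congr (_ * _)%N; rewrite mulnC.
by move=> x; rewrite eq_sym => /negPf ->; rewrite add0n.
Qed.

Lemma perm_zpart la mu : perm_eq la mu -> zpart la = zpart mu.
Proof.
move=> lm; rewrite /zpart (perm_sumn lm); apply: eq_bigr => r _.
by rewrite (seq.permP lm).
Qed.

Lemma mem_rem_notin0 (x : nat) la : 0%N \notin la -> 0%N \notin rem x la.
Proof. by apply: contra; exact: mem_rem. Qed.

Section Pairing.
Variables (C : numFieldType) (s : nat).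
Implicit Types (f g : symfun C) (la mu nu : seq nat).

Local Notation form := (sym_form C s).

Lemma sym_form_lin_combl (I : Type) (r : seq I) (c : I -> C) (F : I -> symfun C) g :
  form (\sum_(i <- r) c i *: F i) g = \sum_(i <- r) c i * form (F i) g.
Proof.
elim/big_rec2: _ => [|i y f _ <-]; first exact: (linear0l (sym_form C s)).
exact: (linearPl (sym_form C s)).
Qed.

Lemma sym_form_lin_combr (I : Type) (r : seq I) (c : I -> C) (F : I -> symfun C) f :
  form f (\sum_(i <- r) c i *: F i) = \sum_(i <- r) c i * form f (F i).
Proof.
elim/big_rec2: _ => [|i y g _ <-]; first exact: (linear0r (sym_form C s)).
exact: (linearPr (sym_form C s)).
Qed.

Lemma perm_sym_p la mu : perm_eq la mu -> sym_p C la = sym_p C mu.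
Proof. by move=> lm; rewrite /sym_p; apply: perm_big. Qed.

(** Removing the sortedness assumption of [sym_formE] lets parts be added to
    and removed from an index without sorting it again. *)
Lemma sym_form_p la mu : 0%N \notin la -> 0%N \notin mu ->
  form (sym_p C la) (sym_p C mu)
  = (perm_eq la mu)%:R * (s%:R ^+ size la * (zpart la)%:R).
Proof.
move=> la0 mu0.
have srt nu : perm_eq nu (sort geq nu) by rewrite perm_sym perm_sort.
rewrite (perm_sym_p (srt la)) (perm_sym_p (srt mu)) sym_formE ?is_part_sort //.
rewrite size_sort -(perm_zpart (srt la)); congr ((nat_of_bool _)%:R * _).
apply/eqP/idP => [E|lm].
  by apply: perm_trans (srt la) _; rewrite E perm_sort.
apply/perm_sortP => //.
- by move=> x y; exact: leq_total.
- by move=> y x z /= h1 h2; exact: leq_trans h2 h1.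
- by move=> x y /= /anti_leq.
Qed.

Lemma sym_p_cons r la : sym_p C (r :: la) = sym_power C r * sym_p C la.
Proof. by rewrite /sym_p big_cons. Qed.

(** If [r] occurs in [la], the summands on the right are all equal, and their
    number is the multiplicity that [zpart_cons] extracts from [zpart la] along
    with the factor [r]; otherwise both sides vanish. *)
Lemma adjoint_power_p r la nu : (0 < r)%N -> 0%N \notin la -> 0%N \notin nu ->
  form (sym_p C la) (sym_power C r * sym_p C nu)
  = s%:R * \sum_(x <- la | x == r) x%:R * form (sym_p C (rem x la)) (sym_p C nu).
Proof.
move=> r_gt0 la0 nu0; rewrite -sym_p_cons sym_form_p //; last first.
  by rewrite inE negb_or nu0 eq_sym -lt0n r_gt0.
rewrite (eq_bigr (fun=> r%:R * form (sym_p C (rem r la)) (sym_p C nu))); last by move=> x /eqP ->.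
rewrite big_const_seq iter_addr addr0.
have [rla|rla] := boolP (r \in la); last first.
  rewrite [count _ _](count_memPn rla) mulr0n mulr0.
  case: (boolP (perm_eq _ _)) => [E|]; last by rewrite mul0r.
  by move: rla; rewrite (perm_mem E) mem_head.
have E := perm_to_rem rla.
rewrite sym_form_p ?mem_rem_notin0 //.
rewrite (permPl E) perm_cons (perm_zpart E) zpart_cons // (perm_size E) /=.
have -> : count (eq_op^~ r) la = (count_mem r (rem r la)).+1.
  by rewrite (seq.permP E) /= eqxx.
case: perm_eq; last by rewrite !mul0r !(mulr0, mul0rn).
rewrite !mul1r exprS !natrM -!mulrA; congr (_ * _).
by rewrite -[in RHS]mulr_natr; ring.
Qed.

(** The adjoint of multiplication by [p_r] is the derivation [s r d/dp_r]. Its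
    value on [p_la] is written as a sum over the occurrences of [r] in [la], so
    that summing over [r] later gives a sum over all the parts of [la]. *)
Lemma adjoint_power r la d f : (0 < r)%N -> 0%N \notin la -> sym_homog d f ->
  form (sym_p C la) (sym_power C r * f)
  = s%:R * \sum_(x <- la | x == r) x%:R * form (sym_p C (rem x la)) f.
Proof.
move=> r_gt0 la0 /sym_homog_expand_p[c ->].
rewrite [in LHS]mulr_sumr; under eq_bigr => nu _ do rewrite -scalerAr.
rewrite sym_form_lin_combr.
under [in RHS]eq_bigr => x _ do rewrite sym_form_lin_combr mulr_sumr.
rewrite exchange_big mulr_sumr /=; apply: eq_bigr => nu _.
rewrite adjoint_power_p //; last by case/andP: (intpart_is_part nu).
rewrite mulrCA mulr_sumr; congr (_ * _).
by apply: eq_bigr => x _; rewrite mulrCA.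
Qed.

End Pairing.

(** * The pairing of power sums with complete functions *)

Section PowerSumCoefficients.
Variable C : numFieldType.
Implicit Types (f g : symfun C) (la : seq nat).

Lemma lepm_mulU n (i : 'I_n) k (m : 'X_{1..n}) : (k <= m i)%N -> (U_(i) *+ k <= m)%MM.
Proof.
move=> le_k; apply/mnm_lepP => j; rewrite mulmnE mnm1E.
by have [<-|_] := eqVneq i j; rewrite ?mul1n ?mul0n.
Qed.

Lemma mcoeff_Xn_mul n (i : 'I_n) k (q : {mpoly C[n]}) (m : 'X_{1..n}) :
  ('X_i ^+ k * q)@_m = (k <= m i)%:R * q@_(m - U_(i) *+ k)%MM.
Proof.
rewrite mpolyXn mulrC; have [le_k|lt_k] := leqP k (m i).
  by rewrite mul1r -{1}(submK (lepm_mulU le_k)) addmC mcoeffMX.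
rewrite mul0r [q]mpolyE mulr_suml raddf_sum big1 // => j _ /=.
rewrite -scalerAl mcoeffZ -mpolyXD mcoeffX; case: eqP => [E|_]; last by rewrite mulr0.
by move: lt_k; rewrite -E mnmDE mulmnE mnm1E eqxx mul1n ltnNge leq_addl.
Qed.

(** Monomials are eigenvectors of the Euler operator [x_i d/dx_i]. *)
Lemma euler_mpolyX n (i : 'I_n) (m : 'X_{1..n}) :
  'X_i * 'X_[m]^`M(i) = (m i)%:R *: 'X_[m] :> {mpoly C[n]}.
Proof.
rewrite mderivX -scalerAr; have [->|m_i] := eqVneq (m i) 0%N; first by rewrite !scale0r.
by rewrite -mpolyXD addmC submK // lep1mP.
Qed.

Lemma mcoeff_euler n (i : 'I_n) (p : {mpoly C[n]}) (m : 'X_{1..n}) :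
  ('X_i * p^`M(i))@_m = (m i)%:R * p@_m.
Proof.
rewrite {1}[p]mpolyE raddf_sum mulr_sumr raddf_sum /= [in RHS](mpolyE p) raddf_sum mulr_sumr /=.
apply: eq_bigr => k _.
rewrite mderivZ -scalerAr euler_mpolyX !mcoeffZ mcoeffX mulrCA.
by case: (k =P m) => [->//|_]; rewrite !mulr0.
Qed.

Lemma euler_power n (i : 'I_n) k : (0 < k)%N ->
  'X_i * (sym_power C k n)^`M(i) = k%:R *: ('X_i ^+ k).
Proof.
case: k => // k _; rewrite /= /nvars /= /power_fam raddf_sum mulr_sumr /=.
rewrite (bigD1 i) //= big1 ?addr0 => [|j ji]; rewrite !mpolyXn euler_mpolyX mulmnE mnm1E.
  by rewrite eqxx mul1n.
by rewrite (negPf ji) mul0n scale0r.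
Qed.

(** The Leibniz rule, since the Euler operator sends [p_x] to [x * x_i ^ x]. *)
Lemma euler_sym_p n (i : 'I_n) la : 0%N \notin la ->
  'X_i * (sym_p C la n)^`M(i) = \sum_(x <- la) x%:R *: ('X_i ^+ x * sym_p C (rem x la) n).
Proof.
elim: la => [_|y la IH].
  by rewrite big_nil /sym_p big_nil (_ : nvars _ _ = 1%:MP) ?mderivC ?mulr0.
rewrite inE negb_or eq_sym -lt0n => /andP[y_gt0 la0].
rewrite sym_p_cons [nvars _ _](_ : _ = sym_power C y n * sym_p C la n) //.
have -> : (sym_power C y n * sym_p C la n)^`M(i)
    = (sym_power C y n)^`M(i) * sym_p C la n + sym_power C y n * (sym_p C la n)^`M(i).
  exact: mderivM.
rewrite mulrDr (mulrA _ (_^`M(i)) _) euler_power // mulrCA IH //.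
rewrite big_cons /= eqxx scalerAl; congr (_ + _).
rewrite mulr_sumr; apply: eq_big_seq => x; have [->|_] := eqVneq y x => xla.
  rewrite -scalerAr; congr (_ *: _); rewrite mulrCA; congr (_ * _).
  by rewrite (perm_sym_p C (perm_to_rem xla)) sym_p_cons.
rewrite sym_p_cons [nvars (_ * _) n](_ : _ = sym_power C y n * sym_p C (rem x la) n) //.
by rewrite -scalerAr mulrCA.
Qed.

Lemma mcoeff_sym_p_recurrence n (i : 'I_n) la (m : 'X_{1..n}) : 0%N \notin la ->
  (m i)%:R * (sym_p C la n)@_m
  = \sum_(x <- la | (x <= m i)%N) x%:R * (sym_p C (rem x la) n)@_(m - U_(i) *+ x)%MM.
Proof.
move=> la0; rewrite -mcoeff_euler euler_sym_p // raddf_sum [RHS]big_mkcond /=.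
apply: eq_bigr => x _; rewrite mcoeffZ mcoeff_Xn_mul.
by case: leqP => _; rewrite ?mul1r ?mul0r ?mulr0.
Qed.

Lemma sum_leq_nat a k : (a <= k)%N -> (\sum_(1 <= r < k.+1) (r <= a) = a)%N.
Proof.
move=> le_ak; rewrite (@big_cat_nat _ _ _ a.+1) //= [X in (_ + X)%N]big1_seq ?addn0; last first.
  by move=> r /andP[_]; rewrite mem_index_iota ltnNge => /andP[/negPf ->].
rewrite (eq_big_nat _ _ (F2 := fun=> 1%N)) ?sum_nat_const_nat ?muln1 ?subn1 //.
by move=> r /andP[_]; rewrite ltnS => ->.
Qed.

(** In the coefficient of a monomial [m] of degree [k], the right-hand side
    counts the pairs of a variable [i] and an [r] with [1 <= r <= m i]; there
    are [\sum_i m i = k] of them. *)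
Lemma newton_complete k :
  k%:R *: sym_complete C k
  = \sum_(1 <= r < k.+1) sym_power C r * sym_complete C (k - r).
Proof.
apply: symfunP => n m.
transitivity ((k * (mdeg m == k))%N%:R : C).
  by rewrite natrM -mcoeff_complete -mcoeffZ.
rewrite -[RHS]/(mcoeff m (symfun_fam _ n)).
have -> : symfun_fam (\sum_(1 <= r < k.+1) sym_power C r * sym_complete C (k - r)) n
   = \sum_(1 <= r < k.+1) \sum_(i < n) 'X_i ^+ r * complete_fam C (k - r) n.
  rewrite [LHS](_ : _ = \sum_(1 <= r < k.+1) sym_power C r n * sym_complete C (k - r) n); last first.
    by elim/big_rec2: _ => // r y x _ <-.
  apply: eq_big_nat => -[|r] // _; rewrite [sym_power _ _ _]/(power_fam _ _ _).
  by rewrite mulr_suml.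
have -> : (k * (mdeg m == k) = \sum_(i < n) \sum_(1 <= r < k.+1) (r <= m i) * (mdeg m == k))%N.
  have [dm|_] := eqVneq (mdeg m) k; last first.
    by rewrite muln0 big1 // => i _; rewrite big1 // => r _; rewrite muln0.
  rewrite muln1 -[LHS]dm mdegE; apply: eq_bigr => i _.
  under eq_bigr => r _ do rewrite muln1.
  by rewrite sum_leq_nat // -dm mdegE (bigD1 i) //= leq_addr.
rewrite exchange_big natr_sum raddf_sum /=; apply: eq_big_nat => r /andP[r_gt0 le_rk].
rewrite natr_sum raddf_sum /=; apply: eq_bigr => i _.
rewrite mcoeff_Xn_mul mcoeff_complete natrM.
case: leqP => [le_r|]; last by rewrite !mul0r.
have -> : mdeg m = (mdeg (m - U_(i) *+ r)%MM + r)%N.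
  by rewrite -{1}(submK (lepm_mulU le_r)) mdegD mdegMn mdeg1 mul1n.
by rewrite -{1}(@subnK r k) // eqn_add2r.
Qed.

Lemma complete0 : sym_complete C 0 = 1.
Proof.
apply: symfunP => n m; rewrite mcoeff_complete mdeg_eq0.
by rewrite [nvars 1 n](_ : _ = 1) // mcoeff1.
Qed.

(** By induction on the degree of [m], as both sides multiplied by [m i]
    satisfy the recurrence of [mcoeff_sym_p_recurrence]. Taking the exponents
    of a monomial as the index of the complete functions, zeros included, makes
    the class of indices stable under that recurrence. *)
Lemma sym_form_p_h s n la (m : 'X_{1..n}) : 0%N \notin la ->
  sym_form C s (sym_p C la) (\prod_(i < n) sym_complete C (m i))
  = s%:R ^+ size la * (sym_p C la n)@_m.
Proof.
have [D le_D] := ubnP (mdeg m); elim: D => // D IH in la m le_D *; move=> la0.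
have [m0|m_neq0] := eqVneq m 0%MM.
  rewrite big1 => [|i _]; last by rewrite m0 mnm0E complete0.
  have -> : 1 = sym_p C [::] by rewrite /sym_p big_nil.
  rewrite sym_form_p //; case: la la0 => [_|x la la0].
    rewrite /= !expr0 !mul1r /zpart big_geq // /sym_p big_nil.
    by rewrite [nvars 1 n](_ : _ = 1) // mcoeff1 m0 eqxx.
  rewrite (_ : perm_eq _ _ = false); last by apply/negP => /perm_size.
  rewrite mul0r (sym_homog_mcoeff0 (sym_homog_p C (x :: la))) ?mulr0 //.
  rewrite m0 mdeg0 eq_sym /=; move: la0; rewrite inE negb_or => /andP[x0 _].
  by rewrite addn_eq0 negb_and eq_sym x0.
have [i mi] : exists i, m i != 0%N.
  apply/existsP; apply: contra_neqT m_neq0 => /existsPn m0.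
  by apply/mnmP => i; rewrite mnm0E; apply/eqP; have := m0 i; rewrite negbK.
apply: (@mulfI _ (m i)%:R); first by rewrite pnatr_eq0.
have mulE : (m i)%:R *: \prod_(j < n) sym_complete C (m j)
    = \sum_(1 <= r < (m i).+1)
        sym_power C r * \prod_(j < n) sym_complete C ((m - U_(i) *+ r)%MM j).
  rewrite (bigD1 i) //= scalerAl newton_complete mulr_suml.
  apply: eq_big_nat => r /andP[r_gt0 _].
  rewrite -mulrA [in RHS](bigD1 i) //= mnmBE mulmnE mnm1E eqxx mul1n.
  congr (_ * (_ * _)); apply: eq_bigr => j ji.
  by rewrite mnmBE mulmnE mnm1E eq_sym (negPf ji) mul0n subn0.
have -> : (m i)%:R * sym_form C s (sym_p C la) (\prod_(j < n) sym_complete C (m j))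
    = sym_form C s (sym_p C la) ((m i)%:R *: \prod_(j < n) sym_complete C (m j)).
  exact: esym (linearZr_LR (sym_form C s) _ _ _).
rewrite mulE [LHS](linear_sumr (sym_form C s)) /=.
(* the recurrence for the coefficients of [p_la] matches the adjoint of [p_r] *)
rewrite mulrCA mcoeff_sym_p_recurrence //.
(* here the induction hypothesis applies, [r > 0] lowering the degree of [m] *)
transitivity (\sum_(1 <= r < (m i).+1) \sum_(x <- la | x == r)
    s%:R ^+ size la * (x%:R * (sym_p C (rem x la) n)@_(m - U_(i) *+ x)%MM)).
  apply: eq_big_nat => r /andP[r_gt0 le_r].
  rewrite (adjoint_power s r_gt0 la0 (sym_homog_prod _
    (fun j => sym_homog_complete C ((m - U_(i) *+ r)%MM j)))).
  rewrite mulr_sumr big_seq_cond [RHS]big_seq_cond; apply: eq_bigr => x /andP[xla /eqP xr].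
  rewrite xr IH ?mem_rem_notin0 //; last first.
    rewrite -ltnS (leq_trans _ le_D) // ltnS.
    rewrite -[in X in (_ < X)%N](submK (lepm_mulU le_r)) mdegD mdegMn mdeg1 mul1n.
    by rewrite -[ltnLHS]addn0 ltn_add2l.
  rewrite -xr (perm_size (perm_to_rem xla)) /= exprS; ring.
(* each part [x] of [la] with [x <= m i] is met once, for [r = x] *)
rewrite (exchange_big_dep xpredT) //= mulr_sumr [RHS]big_mkcond /=.
rewrite big_seq [RHS]big_seq; apply: eq_bigr => x xla.
have x_gt0 : (0 < x)%N by rewrite lt0n; apply: contraNneq la0 => <-.
case: leqP => [le_x|lt_x].
  rewrite (big_rem x) /= ?mem_index_iota ?x_gt0 ?ltnS //= eqxx big1_seq ?addr0 //.
  move=> r /andP[/eqP<-]; rewrite mem_rem_uniq ?iota_uniq // inE eqxx //.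
rewrite big1_seq // => r /andP[/eqP<-]; rewrite mem_index_iota x_gt0 ltnS.
by rewrite leqNgt lt_x.
Qed.

End PowerSumCoefficients.

(** * Integrality: repeating each variable [s] times *)

Section RepeatedVariables.
Variable C : numFieldType.
Variables (s d : nat).

(** The variables are indexed by pairs, and the variable of index [(i, j)] is
    replaced by [x_i]: the plethystic substitution of [s X] for [X]. *)
Definition repeat_vars : #|{: 'I_d * 'I_s}|.-tuple {mpoly C[d]} :=
  [tuple 'X_(enum_val k).1 | k < #|{: 'I_d * 'I_s}|].

Lemma repeat_vars_power k : (0 < k)%N ->
  sym_power C k #|{: 'I_d * 'I_s}| \mPo repeat_vars = s%:R *: sym_power C k d.
Proof.
case: k => // k _; rewrite [sym_power _ _ _]/(power_fam _ _ _) raddf_sum /=.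
under eq_bigr => j _ do rewrite rmorphXn /= comp_mpolyXU -tnth_nth tnth_mktuple.
rewrite -(big_enum_val (fun p : 'I_d * 'I_s => 'X_p.1 ^+ k.+1)) /=.
rewrite -(pair_big xpredT xpredT (fun i (_ : 'I_s) => 'X_i ^+ k.+1)) /=.
rewrite /power_fam scaler_sumr.
by apply: eq_bigr => i _; rewrite sumr_const card_ord scaler_nat.
Qed.

Lemma repeat_vars_sym_p la : 0%N \notin la ->
  sym_p C la #|{: 'I_d * 'I_s}| \mPo repeat_vars = s%:R ^+ size la *: sym_p C la d.
Proof.
elim: la => [_|x la IH].
  rewrite /sym_p !big_nil expr0 scale1r; exact: rmorph1.
rewrite inE negb_or eq_sym -lt0n => /andP[x_gt0 la0].
rewrite sym_p_cons [nvars (_ * _) _]/(sym_power C x _ * sym_p C la _).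
rewrite rmorphM /= repeat_vars_power // IH // -scalerAl -scalerAr scalerA -exprS.
by [].
Qed.

(** The substitution sends monomials to monomials, and [m_la] is a sum of
    monomials. *)
Lemma mcoeff_repeat_vars_m la m :
  exists k : nat, (sym_m C la #|{: 'I_d * 'I_s}| \mPo repeat_vars)@_m = k%:R.
Proof.
rewrite [sym_m _ _ _]/(monomial_fam _ _ _) /monomial_fam (raddf_sum (comp_mpoly repeat_vars)) raddf_sum /=.
elim/big_rec: _ => [|b x _ [k ->]]; first by exists 0%N.
rewrite comp_mpolyX.
under eq_bigr => i _ do rewrite tnth_mktuple mpolyXn.
rewrite mprodXE mcoeffX -natrD; eexists; reflexivity.
Qed.

End RepeatedVariables.

(** * Factorization of the matrices of the forms *)

Definition intr_mx (C : numFieldType) n (A : 'M[int]_n) : 'M[C]_n := map_mx intr A.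

Lemma intr_mx_mul_inj (C : numFieldType) n (A B M : 'M[int]_n) (A' B' M' : 'M[C]_n) :
    intr_mx C A = A' -> intr_mx C B = B' -> intr_mx C M = M' ->
  M' = A' *m B' -> M = A *m B.
Proof.
move=> <- <- <-; rewrite /intr_mx -map_mxM => /matrixP MAB; apply/matrixP => i j.
by have := MAB i j; rewrite mxE [RHS]mxE => /intr_inj.
Qed.

Lemma mulmx_conj (C : comUnitRingType) n (P A B : 'M[C]_n) : P \in unitmx ->
  (invmx P *m A *m P) *m (invmx P *m B *m P) = invmx P *m (A *m B) *m P.
Proof. by move=> Pu; rewrite -!mulmxA mulKVmx. Qed.

Lemma det_conj (C : comUnitRingType) n (P A : 'M[C]_n) : P \in unitmx ->
  \det (invmx P *m A *m P) = \det A.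
Proof. by move=> Pu; rewrite !det_mulmx mulrAC -det_mulmx mulVmx // det1 mul1r. Qed.

Lemma det_intr_mx (C : numFieldType) n (A : 'M[int]_n) :
  \det (intr_mx C A) = (\det A)%:~R.
Proof. exact: det_map_mx. Qed.

Definition size_mx (C : numFieldType) s d : 'M[C]_#|{: intpart d}| :=
  diag_mx (\row_k s%:R ^+ size (enum_val k : intpart d)).

Lemma size_mxM (C : numFieldType) s t d :
  size_mx C (s * t) d = size_mx C s d *m size_mx C t d.
Proof.
rewrite mulmx_diag; congr diag_mx; apply/rowP => k.
by rewrite !mxE natrM exprMn.
Qed.

Lemma det_size_mx (C : numFieldType) s d :
  \det (size_mx C s d)
  = (s%:Z ^+ (\sum_(k < #|{: intpart d}|) size (enum_val k : intpart d)))%:~R.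
Proof.
by rewrite det_diag rmorphXn /= expr_sum; apply: eq_bigr => k _; rewrite mxE.
Qed.

Section FormMatrixFactorization.
Variable R : realType.
Implicit Types s t d : nat.

Lemma sym_h_part_monom (C : numFieldType) d (mu : intpart d) :
  sym_h C mu = \prod_(i < d) sym_complete C (part_monom d mu i).
Proof.
under eq_bigr => i _ do rewrite mnmE.
rewrite /sym_h (big_nth 0%N) -(big_mkord xpredT (fun i => sym_complete C (nth 0%N mu i))).
rewrite [RHS](@big_cat_nat _ _ _ (size mu)) ?size_intpart //=.
rewrite [X in _ * X]big1_seq ?mulr1 // => i.
by rewrite mem_index_iota => /andP[_ /andP[? _]]; rewrite nth_default // complete0.
Qed.

(** Only the rows need a change of basis: the columns [h_mu] are paired with
    power sums by [sym_form_p_h]. *)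
Lemma X_mx_factor s d :
  X_mx R s d = invmx (power_mx R[i] d) *m size_mx R[i] s d *m power_mx R[i] d.
Proof.
apply/matrixP => i j; rewrite !mxE sym_m_expand sym_form_lin_combl.
apply: eq_bigr => k _; rewrite mul_mx_diag !mxE -mulrA; congr (_ * _).
rewrite sym_h_part_monom sym_form_p_h //.
by case/andP: (intpart_is_part (enum_val k : intpart d)).
Qed.

(** By [X_mx_factor], row [i] of [X_s] lists the coefficients of the image of
    [m_la] under the repetition of variables, [la] being the [i]-th partition. *)
Lemma X_mx_nat s d i j : exists k : nat, X_mx R s d i j = k%:R.
Proof.
have [k kE] := mcoeff_repeat_vars_m R[i] s (enum_val i : intpart d) (part_monom d (enum_val j : intpart d)).
exists k; rewrite -kE X_mx_factor sym_m_expand symfun_lin_comb (raddf_sum (comp_mpoly _)) raddf_sum /= mxE.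
apply: eq_bigr => l _; rewrite mul_mx_diag !mxE linearZ mcoeffZ -mulrA; congr (_ * _).
rewrite /= repeat_vars_sym_p ?mcoeffZ //.
by case/andP: (intpart_is_part (enum_val l : intpart d)).
Qed.

Lemma intr_X_int s d : intr_mx R[i] (X_int R s d) = X_mx R s d.
Proof.
apply/matrixP => i j; rewrite 2!mxE; have [k ->] := X_mx_nat s i j.
have -> : complex.Re (k%:R : R[i]) = k%:R by rewrite -(rmorph_nat (real_complex R)).
by rewrite [X in Num.floor X]pmulrn intrKfloor.
Qed.

(** The change of basis does not depend on [s]. *)
Lemma X_mxM s t d : X_mx R (s * t) d = X_mx R s d *m X_mx R t d.
Proof. by rewrite !X_mx_factor size_mxM mulmx_conj ?power_mx_unit. Qed.

Lemma X_intM s t d : X_int R (s * t) d = X_int R s d *m X_int R t d.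
Proof.
exact: intr_mx_mul_inj (intr_X_int s d) (intr_X_int t d) (intr_X_int (s * t) d)
  (X_mxM s t d).
Qed.

Lemma det_X_int s d : exists k, \det (X_int R s d) = s%:Z ^+ k.
Proof.
exists (\sum_(k < #|{: intpart d}|) size (enum_val k : intpart d))%N.
apply: (@intr_inj R[i]); rewrite -det_intr_mx (intr_X_int s d) X_mx_factor.
by rewrite det_conj ?power_mx_unit // det_size_mx.
Qed.

End FormMatrixFactorization.

Theorem theorem1p2 (R : realType) (s t d : nat) :
  X_mx R (s * t) d = X_mx R s d *m X_mx R t d /\
  (coprime s t ->
   smith_nf (X_int R (s * t) d) = smith_nf (X_int R s d) *m smith_nf (X_int R t d)).
Proof.
split=> [|co_st]; first exact: X_mxM.
apply: etrans (congr1 (@smith_nf _) (X_intM R s t d)) _.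
apply: smith_nf_mul_coprime.
have co_pow (x y : int) k l : x = s%:Z ^+ k -> y = t%:Z ^+ l -> coprimez x y.
  by move=> -> ->; rewrite coprimezXl // coprimezXr // coprimezE.
have [[k Ek] [l El]] := (det_X_int R s d, det_X_int R t d).
exact: co_pow Ek El.
Qed.
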